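(* Let $\psi$ and $\chi$ be two MSO formulae over the signature $\{=\}\cup R_2$ such that $(\psi,\chi)$ is cw-size-independent. Then the problem $\psi$-under-$\chi$-dynamics is $\mathsf{P}$-hard under logspace reductions.
   Context: Fix a finite set $R_2$ of binary relation symbols and the signature $\{=\}\cup R_2$. An $R_2$-graph is a pair $G=(V,E)$ with $V$ finite and $E\subseteq R_2\times V\times V$; $|G|=|V|$. MSO formulae over this signature quantify over vertices and sets of vertices. Clique-width: for a finite color set $C$, a $C$-colored $R_2$-graph additionally has a coloring $\mathsf{Col}:V\to C$. Operations: $\mathsf{constant}^{\mathcal R}_c(v)$ (for $\mathcal R\subseteq R_2$, $c\in C$) creates a single vertex $v$ of color $c$ with loops $(r,v,v)$ for $r\in\mathcal R$; $\mathsf{recolor}_f(H)$ (for $f:C\to C$) replaces $\mathsf{Col}_H$ by $f\circ\mathsf{Col}_H$; $\mathsf{join}_M(H,H')$ (for $M\subseteq R_2\times\{\mathsf{left},\mathsf{right}\}\times C^2$) takes the disjoint union of $H,H'$ and, for each $u\in V(H)$, $v\in V(H')$ with colors $c_u,c_v$ and each $r\in R_2$, adds $(r,u,v)$ iff $(r,\mathsf{right},c_u,c_v)\in M$ and adds $(r,v,u)$ iff $(r,\mathsf{left},c_v,c_u)\in M$. A clique-decomposition is a binary tree of such operations (leaves constant, unary nodes recolor, binary nodes join); its width is the number of colors actually used by vertices at some node. The clique-width of an $R_2$-graph $G$ is the minimum width of a clique-decomposition constructing a graph isomorphic to $G$ (forgetting colors). $(\psi,\chi)$ is cw-size-independent if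 there is $k$ such that for infinitely many $n$ there exist $R_2$-graphs $G,G'$ with $n$ vertices and clique-width at most $k$ with $G\models\psi\wedge\chi$ and $G'\models\neg\psi\wedge\chi$. A succinct representation of an $R_2$-graph is a pair $(N,D)$ where $D$ is a Boolean circuit with $2\lceil\log_2 N\rceil$ inputs and $|R_2|$ outputs; it encodes the $R_2$-graph on vertex set $\{0,\dots,N-1\}$ in which $(r,x,y)$ is an arc iff the output of $D$ for $r$ on input $x,y$ is $1$. The problem $\psi$-under-$\chi$-dynamics: given $(N,D)$, with the promise that the encoded graph satisfies $\chi$, decide whether it satisfies $\psi$. *)

(* Defs.v *)
From HB Require Import structures.
From mathcomp Require Import all_boot.

Set Implicit Arguments.
Unset Strict Implicit.
Unset Printing Implicit Defensive.

(** * Graphs and monadic second-order logic *)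

Record rgraph (R2 : finType) := RGraph {
  vert :> finType;
  arc : R2 -> rel vert
}.

Definition isomorphic (R2 : finType) (G H : rgraph R2) : Prop :=
  exists2 f : G -> H, bijective f &
    forall r u v, arc r (f u) (f v) = arc r u v.

(* [X] and [Y] are the types of the free vertex variables and of the free set
   variables; a quantifier binds the extra variable [None]. *)
Inductive mso (R2 : finType) (X Y : Type) : Type :=
| Eq of X & X
| Rel of R2 & X & X
| Mem of X & Y
| Neg of mso R2 X Y
| And of mso R2 X Y & mso R2 X Y
| Or of mso R2 X Y & mso R2 X Y
| ExV of mso R2 (option X) Y
| AllV of mso R2 (option X) Y
| ExS of mso R2 X (option Y)
| AllS of mso R2 X (option Y).

Definition sentence (R2 : finType) := mso R2 void void.

Definition extend (X T : Type) (e : X -> T) (t : T) : option X -> T :=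
  fun o => if o is Some x then e x else t.

Fixpoint sat (R2 : finType) (G : rgraph R2) (X Y : Type) (f : mso R2 X Y) :
    (X -> G) -> (Y -> {set G}) -> bool :=
  match f with
  | Eq x y => fun e _ => e x == e y
  | Rel r x y => fun e _ => arc r (e x) (e y)
  | Mem x A => fun e E => e x \in E A
  | Neg f => fun e E => ~~ sat f e E
  | And f g => fun e E => sat f e E && sat g e E
  | Or f g => fun e E => sat f e E || sat g e E
  | ExV f => fun e E => [exists v : G, sat f (extend e v) E]
  | AllV f => fun e E => [forall v : G, sat f (extend e v) E]
  | ExS f => fun e E => [exists A : {set G}, sat f e (extend E A)]
  | AllS f => fun e E => [forall A : {set G}, sat f e (extend E A)]
  end.

Definition models (R2 : finType) (G : rgraph R2) (f : sentence R2) : bool :=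
  sat (G := G) f (of_void G) (of_void {set G}).

(** * Clique-width *)

Record cgraph (R2 C : finType) := CGraph {
  underlying :> rgraph R2;
  col : underlying -> C
}.

Inductive side := left | right.

(* The name of the vertex created by [Constant] is dropped: clique-width only
   depends on the constructed graph up to isomorphism. A subset [M] of
   R2 * {left, right} * C^2 is given by its characteristic function. *)
Inductive clique_dec (R2 C : finType) : Type :=
| Constant of {set R2} & C
| Recolor of (C -> C) & clique_dec R2 C
| Join of (R2 -> side -> C -> C -> bool) & clique_dec R2 C & clique_dec R2 C.

Section Construction.
Variables R2 C : finType.

Definition constant_graph (A : {set R2}) (c : C) : cgraph R2 C :=
  @CGraph R2 C (@RGraph R2 unit (fun r _ _ => r \in A)) (fun _ => c).

Definition recolor_graph (f : C -> C) (H : cgraph R2 C) : cgraph R2 C :=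
  @CGraph R2 C (underlying H) (fun v => f (col v)).

Definition join_arc (M : R2 -> side -> C -> C -> bool) (H H' : cgraph R2 C)
    (r : R2) : rel (H + H')%type :=
  fun x y => match x, y with
  | inl u, inl v => arc r u v
  | inr u, inr v => arc r u v
  | inl u, inr v => M r right (col u) (col v)
  | inr v, inl u => M r left (col v) (col u)
  end.

Definition join_graph (M : R2 -> side -> C -> C -> bool) (H H' : cgraph R2 C) :
    cgraph R2 C :=
  @CGraph R2 C (@RGraph R2 (H + H')%type (join_arc M (H' := H')))
    (fun x => match x with inl u => col u | inr v => col v end).

Fixpoint graph_of (t : clique_dec R2 C) : cgraph R2 C :=
  match t with
  | Constant A c => constant_graph A c
  | Recolor f t => recolor_graph f (graph_of t)
  | Join M t t' => join_graph M (graph_of t) (graph_of t')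
  end.

Definition colors (t : clique_dec R2 C) : {set C} :=
  [set col v | v : graph_of t].

Fixpoint used_colors (t : clique_dec R2 C) : {set C} :=
  colors t :|: match t with
  | Constant _ _ => set0
  | Recolor _ t => used_colors t
  | Join _ t t' => used_colors t :|: used_colors t'
  end.

Definition width (t : clique_dec R2 C) : nat := #|used_colors t|.

End Construction.

Definition has_dec_of_width (R2 : finType) (G : rgraph R2) (w : nat) : Prop :=
  exists (C : finType) (t : clique_dec R2 C),
    isomorphic G (graph_of t) /\ width t = w.

(* [w] is the clique-width of [G]; it is undefined for the empty graph, which
   has no clique-decomposition. *)
Definition is_cliquewidth (R2 : finType) (G : rgraph R2) (w : nat) : Prop :=
  has_dec_of_width G w /\ forall w', has_dec_of_width G w' -> w <= w'.

Definition cliquewidth_le (R2 : finType) (G : rgraph R2) (k : nat) : Prop :=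
  exists2 w, is_cliquewidth G w & w <= k.

Definition cw_size_independent (R2 : finType) (psi chi : sentence R2) : Prop :=
  exists k : nat, forall m : nat, exists2 n : nat, m <= n &
    exists G G' : rgraph R2,
      [/\ #|G| = n, cliquewidth_le G k & models G (And psi chi)] /\
      [/\ #|G'| = n, cliquewidth_le G' k & models G' (And (Neg psi) chi)].

(** * Boolean circuits and succinct representations *)

(* A circuit is a straight-line program: [GNot], [GAnd] and [GOr] refer to
   earlier gates by their positions. Its outputs are labelled by [O]. *)
Inductive gate :=
| GConst of bool
| GInput of nat
| GNot of nat
| GAnd of nat & nat
| GOr of nat & nat.

Record circuit (O : finType) := Circuit {
  gates : seq gate;
  output : {ffun O -> nat}
}.

Definition gate_wf (m l : nat) (g : gate) : bool :=
  match g with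
  | GConst _ => true
  | GInput i => i < m
  | GNot i => i < l
  | GAnd i j | GOr i j => (i < l) && (j < l)
  end.

(* [m] is the number of inputs. *)
Definition circuit_wf (O : finType) (m : nat) (D : circuit O) : bool :=
  all (fun l => gate_wf m l (nth (GConst false) (gates D) l))
      (iota 0 (size (gates D)))
  && [forall o, output D o < size (gates D)].

Definition gate_eval (inp vals : seq bool) (g : gate) : bool :=
  match g with
  | GConst b => b
  | GInput i => nth false inp i
  | GNot i => ~~ nth false vals i
  | GAnd i j => nth false vals i && nth false vals j
  | GOr i j => nth false vals i || nth false vals j
  end.

Definition circuit_eval (O : finType) (D : circuit O) (inp : seq bool) (o : O) :
    bool :=
  let vals :=
    foldl (fun vals g => rcons vals (gate_eval inp vals g)) [::] (gates D) in
  nth false vals (output D o).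

(* The [w] low-order bits of [n], least significant bit first. *)
Fixpoint bits (w n : nat) : seq bool :=
  if w is w'.+1 then odd n :: bits w' n./2 else [::].

(* [up_log 2 N] is the ceiling of log2 N. *)
Definition succinct_wf (R2 : finType) (N : nat) (D : circuit R2) : bool :=
  (0 < N) && circuit_wf (2 * up_log 2 N) D.

Definition succinct_graph (R2 : finType) (N : nat) (D : circuit R2) :
    rgraph R2 :=
  @RGraph R2 'I_N (fun r x y =>
    circuit_eval D (bits (up_log 2 N) x ++ bits (up_log 2 N) y) r).

(** Encoding of succinct representations as words over {0, 1, #}, where [#] is
    [None] and every number is written in binary. *)

Definition nat_code (n : nat) : seq (option bool) :=
  rcons [seq Some b | b <- bits (up_log 2 n.+1) n] None.

Definition gate_code (g : gate) : seq nat :=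
  match g with
  | GConst b => [:: 0; b : nat; 0]
  | GInput i => [:: 1; i; 0]
  | GNot i => [:: 2; i; 0]
  | GAnd i j => [:: 3; i; j]
  | GOr i j => [:: 4; i; j]
  end.

Definition succinct_code (R2 : finType) (N : nat) (D : circuit R2) :
    seq (option bool) :=
  flatten [seq nat_code n | n <- N :: flatten [seq gate_code g | g <- gates D]
                                  ++ [seq output D r | r <- enum R2]].

Lemma bits_inj (w m n : nat) :
  m < 2 ^ w -> n < 2 ^ w -> bits w m = bits w n -> m = n.
Proof.
elim: w m n => [|w IHw] m n; first by rewrite expn0 !ltnS !leqn0 => /eqP-> /eqP->.
have lt_half p : p < 2 ^ w.+1 -> p./2 < 2 ^ w.
  rewrite expnS mul2n => lt_p; rewrite -ltn_double; apply: leq_ltn_trans lt_p.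
  by rewrite -[leqRHS]odd_double_half leq_addl.
move=> /lt_half lt_m /lt_half lt_n /= [eq_odd /(IHw _ _ lt_m lt_n) eq_half].
by rewrite -[m]odd_double_half -[n]odd_double_half eq_odd eq_half.
Qed.

Lemma nat_code_inj (m n : nat) (s t : seq (option bool)) :
  nat_code m ++ s = nat_code n ++ t -> m = n /\ s = t.
Proof.
have aux (u v : seq bool) : rcons (map Some u) None ++ s =
    rcons (map Some v) None ++ t -> u = v /\ s = t.
  elim: u v => [|a u IHu] [|b v] //=; first by case.
  by case=> -> /IHu[-> ->].
have lt_code p : p < 2 ^ up_log 2 p.+1 by apply: up_logP.
have size_bits w p : size (bits w p) = w.
  by elim: w p => //= w IHw p; rewrite IHw.
move=> /aux[eq_b ->]; split=> //.
have eq_w : up_log 2 m.+1 = up_log 2 n.+1.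
  by rewrite -[LHS](size_bits _ m) eq_b size_bits.
apply: bits_inj (lt_code m) _ _; first by rewrite eq_w.
by rewrite eq_b eq_w.
Qed.

(* The encoding is unambiguous, so the yes-instances and the no-instances of
   the promise problem below are disjoint. *)
Lemma succinct_code_inj (R2 : finType) (N N' : nat) (D D' : circuit R2) :
  succinct_code N D = succinct_code N' D' -> N = N' /\ D = D'.
Proof.
have flat_inj : injective (fun s => flatten (map nat_code s)).
  elim=> [|m s IHs] [|n t] //=; try by rewrite /nat_code; case: map.
  by move=> /nat_code_inj[-> /IHs->].
move=> /flat_inj[-> eq_c]; split=> //.
case: D D' eq_c => [gs o] [gs' o'] /= eq_c.
have size_g (l : seq gate) : size (flatten (map gate_code l)) = 3 * size l.
  by elim: l => [|[b|i|i|i j|i j] l IHl] //=; rewrite IHl mulnS.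
have eq_s : size gs = size gs'.
  have /eqP := congr1 size eq_c.
  by rewrite !size_cat !size_map eqn_add2r !size_g eqn_pmul2l // => /eqP.
have /eqP := eq_c; rewrite eqseq_cat ?size_g ?eq_s // => /andP[/eqP eq_g /eqP].
move=> /eq_in_map eq_o; congr Circuit; last first.
  by apply/ffunP => r; rewrite eq_o ?mem_enum.
elim: gs gs' eq_g {eq_c eq_s} => [|g gs IHgs] [|g' gs'] //=.
- by case: g'.
- by case: g.
by case: g => [[]|i|i|i j|i j]; case: g' => [[]|i'|i'|i' j'|i' j'] //= [] *;
  subst; congr cons; apply: IHgs.
Qed.

(** * Polynomial time, logarithmic space, hardness *)

Inductive move := MoveL | Stay | MoveR.

(* Tapes are infinite to the right only; moving left from cell 0 has no
   effect. *)
Definition shift (d : move) (h : nat) : nat :=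
  match d with MoveL => h.-1 | Stay => h | MoveR => h.+1 end.

Definition write (A : Type) (tape : nat -> A) (h : nat) (a : A) : nat -> A :=
  fun i => if i == h then a else tape i.

(** Deterministic single-tape Turing machines. The blank symbol is [None]. *)

Record tm (S : finType) := TM {
  tm_state : finType;
  tm_aux : finType;
  tm_start : tm_state;
  tm_verdict : tm_state -> option bool;
  tm_trans : tm_state -> option (S + tm_aux) ->
             tm_state * option (S + tm_aux) * move
}.

Record tm_config (S : finType) (M : tm S) := TMConfig {
  tm_cur : tm_state M;
  tm_tape : nat -> option (S + tm_aux M);
  tm_head : nat
}.

Definition tm_init (S : finType) (M : tm S) (x : seq S) : tm_config M :=
  TMConfig (tm_start M) (fun i => omap inl (onth x i)) 0.

(* A state with a verdict is halting: the configuration no longer changes. *)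
Definition tm_step (S : finType) (M : tm S) (c : tm_config M) : tm_config M :=
  if tm_verdict (tm_cur c) is Some _ then c else
  let: (q, a, d) := tm_trans (tm_cur c) (tm_tape c (tm_head c)) in
  TMConfig q (write (tm_tape c) (tm_head c) a) (shift d (tm_head c)).

Definition tm_run (S : finType) (M : tm S) (x : seq S) (t : nat) :
    tm_config M :=
  iter t (@tm_step S M) (tm_init M x).

(* By the convention above, the machine halts within [size x ^ c + c] steps. *)
Definition in_P (S : finType) (L : seq S -> Prop) : Prop :=
  exists (M : tm S) (c : nat), forall x : seq S,
    exists2 b, tm_verdict (tm_cur (tm_run M x (size x ^ c + c))) = Some b &
               b <-> L x.

(** Deterministic transducers with a two-way read-only input tape between two
    end markers, [tr_k] work tapes, and a write-only output tape. *)

Record transducer (S T : finType) := Transducer {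
  tr_state : finType;
  tr_aux : finType;
  tr_k : nat;
  tr_start : tr_state;
  tr_halt : pred tr_state;
  (* The input symbol is [inl false] (left end), [inl true] (right end), or
     [inr s]. *)
  tr_next : tr_state -> bool + S -> {ffun 'I_tr_k -> option tr_aux} ->
            tr_state * move;
  tr_work : tr_state -> bool + S -> {ffun 'I_tr_k -> option tr_aux} ->
            'I_tr_k -> option tr_aux * move;
  tr_emit : tr_state -> bool + S -> {ffun 'I_tr_k -> option tr_aux} ->
            option T
}.

Record tr_config (S T : finType) (M : transducer S T) := TRConfig {
  tr_cur : tr_state M;
  tr_inhead : nat;
  tr_tape : 'I_(tr_k M) -> nat -> option (tr_aux M);
  tr_head : 'I_(tr_k M) -> nat;
  tr_out : seq T
}.

Definition tr_init (S T : finType) (M : transducer S T) : tr_config M :=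
  TRConfig (tr_start M) 0 (fun _ _ => None) (fun _ => 0) [::].

(* The input tape has cells 0 (left end marker), 1, .., size x (the input) and
   (size x).+1 (right end marker). *)
Definition in_sym (S : finType) (x : seq S) (h : nat) : bool + S :=
  if h is i.+1 then if onth x i is Some s then inr s else inl true
  else inl false.

(* The input head cannot leave the input tape, so that its position cannot be
   used as an unbounded counter. *)
Definition tr_step (S T : finType) (M : transducer S T) (x : seq S)
    (c : tr_config M) : tr_config M :=
  if tr_halt (tr_cur c) then c else
  let q := tr_cur c in
  let a := in_sym x (tr_inhead c) in
  let w := [ffun i => tr_tape c i (tr_head c i)] in
  TRConfig (tr_next q a w).1
    (minn (shift (tr_next q a w).2 (tr_inhead c)) (size x).+1)
    (fun i => write (tr_tape c i) (tr_head c i) (tr_work q a w i).1)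
    (fun i => shift (tr_work q a w i).2 (tr_head c i))
    (if tr_emit q a w is Some o then rcons (tr_out c) o else tr_out c).

Definition tr_run (S T : finType) (M : transducer S T) (x : seq S) (t : nat) :
    tr_config M :=
  iter t (@tr_step S T M x) (tr_init M).

Definition logspace_computable (S T : finType) (f : seq S -> seq T) : Prop :=
  exists (M : transducer S T) (c : nat), forall x : seq S,
    (exists t, tr_halt (tr_cur (tr_run M x t)) /\ tr_out (tr_run M x t) = f x)
    /\ (forall t i, tr_head (tr_run M x t) i <= c * up_log 2 (size x) + c).

Record promise_problem (T : finType) := PromiseProblem {
  yes_instance : seq T -> Prop;
  no_instance : seq T -> Prop
}.

Definition P_hard (T : finType) (Q : promise_problem T) : Prop :=
  forall (S : finType) (L : seq S -> Prop), in_P L ->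
    exists f : seq S -> seq T, logspace_computable f /\
      forall x, (L x -> yes_instance Q (f x)) /\ (~ L x -> no_instance Q (f x)).

Definition under_dynamics (R2 : finType) (psi chi : sentence R2) :
    promise_problem (option bool) :=
  PromiseProblem
    (fun s => exists (N : nat) (D : circuit R2),
       [/\ succinct_wf N D, s = succinct_code N D,
           models (succinct_graph N D) chi &
           models (succinct_graph N D) psi])
    (fun s => exists (N : nat) (D : circuit R2),
       [/\ succinct_wf N D, s = succinct_code N D,
           models (succinct_graph N D) chi &
           ~~ models (succinct_graph N D) psi]).

(* Main.v *)
From mathcomp Require Import all_boot zify.
Require Import Defs.

Set Implicit Arguments.
Unset Strict Implicit.
Unset Printing Implicit Defensive.

(** A single pair of graphs [G], [G'] of the same size [n >= 1], with [G] a
    model of [psi /\ chi] and [G'] one of [~ psi /\ chi], is enough.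
    Let [M] decide a language in polynomial time. The
    instance built from a word [x] has the fixed size [n], and its circuit
    evaluates the space-time diagram of [M] on [x], which does not depend on the
    two vertices given as inputs, then answers with the arcs of [G] if [M]
    accepts and with those of [G'] otherwise.

    The diagram is a sequence of identical blocks of gates, each reading three
    neighbouring blocks of the previous row at a fixed distance. A transducer
    can thus write the circuit while maintaining every address it needs on its
    own work tape: the only arithmetic is to increment binary counters. The rows
    have length [2 ^ (l * k) + 1], where [2 ^ l > size x + 1], so that loops over
    rows and blocks are nested loops over counters of [l] bits. *)

(** * Monadic second-order logic and isomorphisms *)

Lemma sat_iso (R2 : finType) (G H : rgraph R2) (f : G -> H) :
  bijective f -> (forall r u v, arc r (f u) (f v) = arc r u v) ->
  forall (X Y : Type) (phi : mso R2 X Y) (e : X -> G) (e' : X -> H)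
      (E : Y -> {set G}) (E' : Y -> {set H}),
    (forall x, e' x = f (e x)) -> (forall y, E' y = f @: E y) ->
    sat (G := H) phi e' E' = sat (G := G) phi e E.
Proof.
move=> bij_f arc_f; have inj_f := bij_inj bij_f; have [g fK gK] := bij_f.
have imK (A : {set H}) : A = f @: (g @: A).
  by rewrite -imset_comp (eq_imset (g := id)) ?imset_id // => x /=; rewrite gK.
move=> X Y; elim=> {X Y} /=.
- by move=> X Y x y e e' E E' He HE; rewrite !He (inj_eq inj_f).
- by move=> X Y r x y e e' E E' He HE; rewrite !He arc_f.
- by move=> X Y x A e e' E E' He HE; rewrite He HE mem_imset.
- by move=> X Y phi IH e e' E E' He HE; rewrite (IH e _ E).
- by move=> X Y phi IH psi IH' e e' E E' He HE; rewrite (IH e _ E) // (IH' e _ E).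
- by move=> X Y phi IH psi IH' e e' E E' He HE; rewrite (IH e _ E) // (IH' e _ E).
- move=> X Y phi IH e e' E E' He HE.
  apply/existsP/existsP=> [[v Hv]|[v Hv]].
    by exists (g v); rewrite -(IH _ (extend e' v) _ E') //; case=> //=; rewrite gK.
  by exists (f v); rewrite (IH (extend e v) _ E) //; case.
- move=> X Y phi IH e e' E E' He HE.
  apply/forallP/forallP=> Hv v.
    by rewrite -(IH _ (extend e' (f v)) _ E') //; case.
  by rewrite (IH (extend e (g v)) _ E) //; case=> //=; rewrite gK.
- move=> X Y phi IH e e' E E' He HE.
  apply/existsP/existsP=> [[A HA]|[A HA]].
    by exists (g @: A); rewrite -(IH _ e' _ (extend E' A)) //; case=> //=.
  by exists (f @: A); rewrite (IH e _ (extend E A)) //; case.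
move=> X Y phi IH e e' E E' He HE.
apply/forallP/forallP=> HA A.
  by rewrite -(IH _ e' _ (extend E' (f @: A))) //; case.
by rewrite (IH e _ (extend E (g @: A))) //; case=> //=.
Qed.

Lemma models_iso (R2 : finType) (G H : rgraph R2) (phi : sentence R2) :
  isomorphic G H -> models H phi = models G phi.
Proof. by move=> [f bij_f arc_f]; apply: (sat_iso bij_f arc_f) => -[]. Qed.

(** * Compiling Boolean functions to circuits *)

Inductive form (V : Type) :=
| FConst of bool
| FVar of V
| FNot of form V
| FAnd of form V & form V
| FOr of form V & form V.
Arguments FConst {V}.

Fixpoint feval (V : Type) (e : V -> bool) (f : form V) : bool :=
  match f with
  | FConst b => b
  | FVar v => e v
  | FNot f => ~~ feval e f
  | FAnd f g => feval e f && feval e g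
  | FOr f g => feval e f || feval e g
  end.

Fixpoint fsize (V : Type) (f : form V) : nat :=
  match f with
  | FConst _ | FVar _ => 1
  | FNot f => (fsize f).+1
  | FAnd f g | FOr f g => (fsize f + fsize g).+1
  end.

Definition form_of (V : finType) (h : {ffun V -> bool} -> bool) : form V :=
  foldr (@FOr V) (FConst false)
    [seq foldr (@FAnd V) (FConst true)
           [seq if a v then FVar v else FNot (FVar v) | v <- enum V]
    | a : {ffun V -> bool} <- enum {: {ffun V -> bool}} & h a].

Lemma feval_form_of (V : finType) (h : {ffun V -> bool} -> bool) e :
  feval e (form_of h) = h [ffun v => e v].
Proof.
have evalO s : feval e (foldr (@FOr V) (FConst false) s) = has (feval e) s.
  by elim: s => //= f s ->.
have evalA s : feval e (foldr (@FAnd V) (FConst true) s) = all (feval e) s.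
  by elim: s => //= f s ->.
rewrite evalO has_map; apply/hasP/idP => [[a]|h_e].
  rewrite mem_filter => /andP[h_a _] /=; rewrite evalA all_map => /allP eval_a.
  suff <- : a = [ffun v => e v] by [].
  apply/ffunP => v; rewrite ffunE.
  by have /= := eval_a v (mem_enum _ v); case: (a v) => /= [->|/negPf->].
exists [ffun v => e v]; first by rewrite mem_filter h_e mem_enum.
rewrite /= evalA all_map; apply/allP => v _ /=; rewrite ffunE.
by case E: (e v) => /=; rewrite E.
Qed.

(* With symbolic operands in [O], a block of gates that is repeated in a circuit
   is compiled only once. *)
Inductive tgate (O : Type) :=
| TConst of bool
| TInput of nat
| TNot of O
| TAnd of O & O
| TOr of O & O.
Arguments TConst {O}.
Arguments TInput {O}.

Definition inst (O : Type) (h : O -> nat) (g : tgate O) : gate :=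
  match g with
  | TConst b => GConst b
  | TInput i => GInput i
  | TNot a => GNot (h a)
  | TAnd a b => GAnd (h a) (h b)
  | TOr a b => GOr (h a) (h b)
  end.

Definition eval_from (inp vals : seq bool) (gs : seq gate) : seq bool :=
  foldl (fun vals g => rcons vals (gate_eval inp vals g)) vals gs.

Lemma eval_from_cat inp vals gs gs' :
  eval_from inp vals (gs ++ gs') = eval_from inp (eval_from inp vals gs) gs'.
Proof. exact: foldl_cat. Qed.

(* [gs] is well formed when placed at position [l] in a circuit. *)
Fixpoint gates_wf (m l : nat) (gs : seq gate) : bool :=
  if gs is g :: gs then gate_wf m l g && gates_wf m l.+1 gs else true.

Lemma gates_wf_cat m l gs gs' :
  gates_wf m l (gs ++ gs') = gates_wf m l gs && gates_wf m (l + size gs) gs'.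
Proof.
elim: gs l => [|g gs IH] l /=; first by rewrite addn0.
by rewrite IH addSnnS andbA.
Qed.

Lemma gates_wfP m gs :
  gates_wf m 0 gs ->
  all (fun l => gate_wf m l (nth (GConst false) gs l)) (iota 0 (size gs)).
Proof.
have wf_nth k l : gates_wf m k gs -> l < size gs ->
    gate_wf m (k + l) (nth (GConst false) gs l).
  elim: gs k l => [|g gs IH] k [|l] //= /andP[wf_g wf_gs]; first by rewrite addn0.
  by move=> lt_l; rewrite -addSnnS IH.
by move=> wf_gs; apply/allP => l; rewrite mem_iota => /andP[_] /(wf_nth _ _ wf_gs).
Qed.

Section Compile.
Variables (O V : Type) (loc : nat -> O) (vg : V -> tgate O).

(* Postfix order: the value of [f] is computed by the last gate. *)
Fixpoint comp (f : form V) (p : nat) : seq (tgate O) :=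
  match f with
  | FConst b => [:: TConst b]
  | FVar v => [:: vg v]
  | FNot f => rcons (comp f p) (TNot (loc (p + fsize f).-1))
  | FAnd f g => rcons (comp f p ++ comp g (p + fsize f))
      (TAnd (loc (p + fsize f).-1) (loc (p + fsize f + fsize g).-1))
  | FOr f g => rcons (comp f p ++ comp g (p + fsize f))
      (TOr (loc (p + fsize f).-1) (loc (p + fsize f + fsize g).-1))
  end.

Lemma size_comp f p : size (comp f p) = fsize f.
Proof.
elim: f p => //= [f IH|f IHf g IHg|f IHf g IHg] p; rewrite size_rcons ?size_cat.
- by rewrite IH.
- by rewrite IHf IHg.
- by rewrite IHf IHg.
Qed.

Lemma fsize_gt0 (f : form V) : 0 < fsize f.
Proof. by case: f. Qed.

Fixpoint comps (fs : seq (form V)) (p : nat) : seq (tgate O) :=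
  if fs is f :: fs then comp f p ++ comps fs (p + fsize f) else [::].

Fixpoint positions (fs : seq (form V)) (p : nat) : seq nat :=
  if fs is f :: fs then (p + fsize f).-1 :: positions fs (p + fsize f) else [::].

Definition fsizes (fs : seq (form V)) : nat := sumn [seq fsize f | f <- fs].

(* The final copies put the values of [fs] in the last [size fs] gates. *)
Definition block (fs : seq (form V)) : seq (tgate O) :=
  comps fs 0 ++ [seq TAnd (loc a) (loc a) | a <- positions fs 0].

Definition block_size (fs : seq (form V)) : nat := fsizes fs + size fs.

Lemma size_comps fs p : size (comps fs p) = fsizes fs.
Proof. by elim: fs p => //= f fs IH p; rewrite size_cat size_comp IH. Qed.

Lemma size_positions fs p : size (positions fs p) = size fs.
Proof. by elim: fs p => //= f fs IH p; rewrite IH. Qed.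

Lemma size_block fs : size (block fs) = block_size fs.
Proof. by rewrite size_cat size_map size_comps size_positions. Qed.

Variables (h : O -> nat) (base : nat).
Hypothesis h_loc : forall p, h (loc p) = base + p.

Section Eval.
Variables (inp : seq bool) (e : V -> bool) (start : seq bool).
Hypothesis eval_vg : forall v us,
  gate_eval inp (start ++ us) (inst h (vg v)) = e v.

Lemma nth_last_mid (us vs ws : seq bool) n : 0 < size vs ->
  n = (size us + size vs).-1 -> nth false (us ++ vs ++ ws) n = last false vs.
Proof.
move=> vs_gt0 ->; rewrite nth_cat -subn1 -addnBA // ltnNge leq_addr /= addKn.
by rewrite nth_cat subn1 prednK // leqnn nth_last; case: vs vs_gt0.
Qed.

Lemma eval_comp f (us : seq bool) p : size (start ++ us) = base + p ->
  exists vs, [/\ eval_from inp (start ++ us) (map (inst h) (comp f p))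
                 = start ++ us ++ vs,
                 size vs = fsize f & last false vs = feval e f].
Proof.
have binary (op : bool -> bool -> bool) (T : O -> O -> tgate O) (f1 f2 : form V) :
    (forall vals a b, gate_eval inp vals (inst h (T a b)) =
       op (nth false vals (h a)) (nth false vals (h b))) ->
    (forall (us : seq bool) p, size (start ++ us) = base + p ->
      exists vs, [/\ eval_from inp (start ++ us) (map (inst h) (comp f1 p))
                   = start ++ us ++ vs,
                   size vs = fsize f1 & last false vs = feval e f1]) ->
    (forall (us : seq bool) p, size (start ++ us) = base + p ->
      exists vs, [/\ eval_from inp (start ++ us) (map (inst h) (comp f2 p))
                   = start ++ us ++ vs,
                   size vs = fsize f2 & last false vs = feval e f2]) ->
    forall (us : seq bool) p, size (start ++ us) = base + p ->
      exists vs, [/\ eval_from inp (start ++ us) (map (inst h)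
          (rcons (comp f1 p ++ comp f2 (p + fsize f1))
             (T (loc (p + fsize f1).-1) (loc (p + fsize f1 + fsize f2).-1))))
                   = start ++ us ++ vs,
                   size vs = (fsize f1 + fsize f2).+1
                 & last false vs = op (feval e f1) (feval e f2)].
  move=> evalT IH1 IH2 {}us {}p sz_us.
  have [vs [eq_vs sz_vs last_vs]] := IH1 us p sz_us.
  have f1_gt0 := fsize_gt0 f1; have f2_gt0 := fsize_gt0 f2.
  have [|ws [eq_ws sz_ws last_ws]] := IH2 (us ++ vs) (p + fsize f1).
    by rewrite catA size_cat sz_us sz_vs addnA.
  exists (rcons (vs ++ ws) (op (feval e f1) (feval e f2))).
  split; rewrite ?size_rcons ?size_cat ?sz_vs ?sz_ws ?last_rcons //.
  rewrite map_rcons map_cat -cats1 !eval_from_cat eq_vs eq_ws.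
  rewrite /eval_from [foldl _ _ _]/= evalT !h_loc.
  have -> : nth false (start ++ (us ++ vs) ++ ws) (base + (p + fsize f1).-1) =
            feval e f1.
    by rewrite -last_vs -catA catA (nth_last_mid (us := start ++ us)) ?sz_vs ?sz_us;
      lia.
  have -> : nth false (start ++ (us ++ vs) ++ ws) (base + (p + fsize f1 + fsize f2).-1)
            = feval e f2.
    rewrite -last_ws -[ws in LHS]cats0 catA (nth_last_mid (us := start ++ _)) //.
      by rewrite sz_ws.
    by rewrite catA size_cat sz_us sz_ws sz_vs; lia.
  by rewrite -!cats1 -!catA.
elim: f us p => [b|v|f IH|f IHf g IHg|f IHf g IHg] us p sz_us.
- by exists [:: b]; rewrite /eval_from /= -cats1 -catA.
- by exists [:: e v]; rewrite /eval_from /= eval_vg -cats1 -catA.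
- have [vs [eq_vs sz_vs last_vs]] := IH us p sz_us; have f_gt0 := fsize_gt0 f.
  exists (rcons vs (~~ feval e f)); split; rewrite ?size_rcons ?sz_vs ?last_rcons //.
  rewrite [comp _ _]/= map_rcons -cats1 eval_from_cat eq_vs /eval_from /= h_loc.
  rewrite -[vs]cats0 catA nth_last_mid ?sz_vs ?sz_us; try lia.
  by rewrite last_vs -!cats1 -!catA.
- exact: (binary andb).
- exact: (binary orb).
Qed.

Lemma eval_comps fs (us : seq bool) p : size (start ++ us) = base + p ->
  exists vs, [/\ eval_from inp (start ++ us) (map (inst h) (comps fs p))
                 = start ++ us ++ vs,
                 size vs = fsizes fs &
                 forall ws, [seq nth false (start ++ us ++ vs ++ ws) (base + a)
                            | a <- positions fs p] = map (feval e) fs].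
Proof.
elim: fs us p => [|f fs IH] us p sz_us /=.
  by exists [::]; split; rewrite ?cats0.
have [vs [eq_vs sz_vs last_vs]] := eval_comp f sz_us; have f_gt0 := fsize_gt0 f.
have [|xs [eq_xs sz_xs pos_xs]] := IH (us ++ vs) (p + fsize f).
  by rewrite catA size_cat sz_us sz_vs addnA.
exists (vs ++ xs); split.
- by rewrite map_cat eval_from_cat eq_vs eq_xs -!catA.
- by rewrite size_cat sz_vs sz_xs.
move=> ws; congr cons.
  by rewrite -last_vs -catA catA nth_last_mid ?sz_vs ?sz_us; lia.
by rewrite -(pos_xs ws) -!catA.
Qed.

Lemma eval_copies (vals xs ys : seq bool) ps :
  (forall ws, [seq nth false (vals ++ ws) (base + a) | a <- ps] = ys) ->
  eval_from inp (vals ++ xs)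
    (map (inst h) [seq TAnd (loc a) (loc a) | a <- ps]) = vals ++ xs ++ ys.
Proof.
elim: ps xs ys => [|a ps IH] xs ys pos_ps; first by rewrite -(pos_ps [::]) /= cats0.
case: ys pos_ps => [|y ys] pos_ps; first by have := pos_ps [::].
rewrite /eval_from /= -/(eval_from _ _ _) !h_loc andbb -cats1 -catA (IH _ ys).
  by have := pos_ps xs; case=> -> _; rewrite -!catA.
by move=> ws; case: (pos_ps ws).
Qed.

Lemma eval_block fs : size start = base ->
  exists2 vs, eval_from inp start (map (inst h) (block fs)) =
              start ++ vs ++ map (feval e) fs & size vs = fsizes fs.
Proof.
move=> sz_start.
have [|vs [eq_vs sz_vs pos_vs]] := @eval_comps fs [::] 0.
  by rewrite cats0 sz_start addn0.
exists vs => //; rewrite map_cat eval_from_cat.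
move: eq_vs; rewrite cats0 => ->; rewrite /= -[start ++ vs]cats0.
rewrite (@eval_copies _ _ (map (feval e) fs)) -?catA // => ws.
by rewrite -(pos_vs ws) /= -catA.
Qed.

End Eval.

Section WellFormed.
Variable m : nat.
Hypothesis wf_vg : forall v l, base <= l -> gate_wf m l (inst h (vg v)).

Lemma wf_comp f p : gates_wf m (base + p) (map (inst h) (comp f p)).
Proof.
elim: f p => [b|v|f IH|f IHf g IHg|f IHf g IHg] p /=.
- by [].
- by rewrite wf_vg // leq_addr.
- rewrite map_rcons -cats1 gates_wf_cat IH /= size_map size_comp h_loc.
  by have := fsize_gt0 f; lia.
- rewrite map_rcons map_cat -cats1 !gates_wf_cat IHf /= !size_cat !size_map !size_comp.
  rewrite -addnA IHg /= !h_loc; have := fsize_gt0 f; have := fsize_gt0 g; lia.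
rewrite map_rcons map_cat -cats1 !gates_wf_cat IHf /= !size_cat !size_map !size_comp.
rewrite -addnA IHg /= !h_loc; have := fsize_gt0 f; have := fsize_gt0 g; lia.
Qed.

Lemma wf_block fs : gates_wf m base (map (inst h) (block fs)).
Proof.
have wf_comps p : gates_wf m (base + p) (map (inst h) (comps fs p)).
  elim: fs p => //= f fs IH p.
  by rewrite map_cat gates_wf_cat wf_comp size_map size_comp -addnA IH.
rewrite map_cat gates_wf_cat -{1}[base]addn0 wf_comps size_map size_comps /=.
have pos_lt (q : seq (form V)) p a : a \in positions q p -> a < p + fsizes q.
  elim: q p => //= f q IH p; have f_gt0 := fsize_gt0 f.
  rewrite inE /fsizes /= => /orP[/eqP->|/IH]; first by lia.
  by rewrite /fsizes addnA.
have : all (fun a => a < fsizes fs) (positions fs 0).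
  by apply/allP => a /pos_lt.
move: (fsizes fs) => s; elim: (positions fs 0) s => //= a ps IH s /andP[lt_a lt_ps].
rewrite !h_loc ltn_add2l lt_a /= -addnS IH //.
by apply: sub_all lt_ps => b; apply: leqW.
Qed.

End WellFormed.
End Compile.

(** * Space-time diagrams of Turing machines *)

Section Cells.
Variables (S : finType) (M : tm S).

(* tape symbol, state of the head if it is here, whether this is cell 0 *)
Definition cell : finType :=
  (option (S + tm_aux M) * option (tm_state M) * bool)%type.

Definition action (c : cell) :
    option (tm_state M * option (S + tm_aux M) * move) :=
  if c.1.2 is Some q then
    Some (if tm_verdict q is Some _ then (q, c.1.1, Stay) else tm_trans q c.1.1)
  else None.

(* The left neighbour of cell 0 and a right neighbour flagged as cell 0 are
   ignored: in the circuit, the rows of the space-time diagram follow each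
   other without separation. *)
Definition delta (l m r : cell) : cell :=
  (if action m is Some (_, a, _) then a else m.1.1,
   match action m with
   | Some (q, _, Stay) => Some q
   | Some (q, _, MoveL) => if m.2 then Some q else None
   | Some (_, _, MoveR) => None
   | None =>
     match (if m.2 then None else action l) with
     | Some (q, _, MoveR) => Some q
     | _ => match (if r.2 then None else action r) with
            | Some (q, _, MoveL) => Some q
            | _ => None
            end
     end
   end,
   m.2).

Definition cell_of (c : tm_config M) (i : nat) : cell :=
  (tm_tape c i, if tm_head c == i then Some (tm_cur c) else None, i == 0).

Lemma cell_of_step c i l r :
  (0 < i -> l = cell_of c i.-1) ->
  r = cell_of c i.+1 \/ r.2 /\ tm_head c != i.+1 ->
  cell_of (tm_step c) i = delta l (cell_of c i) r.
Proof.
case: c => q tp h hl hr.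
have -> : cell_of (tm_step (TMConfig q tp h)) i =
  let: (q', a, d) := if tm_verdict q is Some _ then (q, tp h, Stay)
                     else tm_trans q (tp h) in
  cell_of (TMConfig q' (write tp h a) (shift d h)) i.
  rewrite /tm_step /=; case: (tm_verdict q) => [b|]; last by case: tm_trans => [[]].
  by rewrite /cell_of /= /write; case: (eqVneq i h) => // ->.
rewrite /delta /cell_of /action /=.
have [->|ne_hi] := eqVneq h i.
  case E: (if _ is Some _ then _ else _) => [[q' a] d] /=.
  rewrite /write eqxx; case: d E => E /=; last 2 first.
  - by rewrite eqxx.
  - by rewrite -[i.+1 == i]/(_ == _) gtn_eqF.
  case: i {hl hr E} => [|i] //=; by rewrite ltn_eqF.
have left_act : (if i == 0 then None else action l) =
    if h.+1 == i then Some (if tm_verdict q is Some _ then (q, tp h, Stay)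
                     else tm_trans q (tp h)) else None.
  case: i hl {hr} ne_hi => [|i] hl ne_hi //=; rewrite hl // /action /= eqSS.
  by case: eqP => // ->.
have right_act : (if r.2 then None else action r) =
    if h == i.+1 then Some (if tm_verdict q is Some _ then (q, tp h, Stay)
                     else tm_trans q (tp h)) else None.
  case: hr => [->|[-> /negPf /= -> //]]; rewrite /action /=.
  by case: eqP => // ->.
move: left_act right_act; rewrite /action => -> ->.
case: (if tm_verdict q is Some _ then _ else _) => [[q' a] d] /=.
rewrite /write eq_sym (negPf ne_hi).
clear hl hr; congr (_, _, _); case: d => /=.
- case: h ne_hi => [|h] /=; first by rewrite eq_sym => /negPf ->; case: ifP.
  by rewrite eqSS => ne; case: (h.+2 == i); case: (h == i).
- by rewrite (negPf ne_hi); case: ifP; case: ifP.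
by case: (h.+1 == i) => //; case: ifP.
Qed.

Section Run.
Variables (x : seq S) (T : nat) (b : bool).
Hypothesis halts : tm_verdict (tm_cur (tm_run M x T)) = Some b.

Lemma tm_runS t : tm_run M x t.+1 = tm_step (tm_run M x t).
Proof. by []. Qed.

Lemma tm_run_halted t : T <= t -> tm_run M x t = tm_run M x T.
Proof.
move/subnK <-; elim: (t - T) => // s IH.
by rewrite addSn tm_runS IH /tm_step halts.
Qed.

Lemma tm_head_run_le t : tm_head (tm_run M x t) <= T.
Proof.
have head_le s : tm_head (tm_run M x s) <= s.
  elim: s => // s; rewrite tm_runS /tm_step.
  case: (tm_verdict _) => [_|]; first exact: leqW.
  by case: (tm_trans _ _) => [[q a] []] /=; lia.
by case: (leqP T t) => [/tm_run_halted -> //|/ltnW]; apply: leq_trans.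
Qed.

Lemma accept_only_final t : tm_verdict (tm_cur (tm_run M x t)) = Some true -> b.
Proof.
move=> acc; case: (leqP T t) => [/tm_run_halted eq_t|lt_tT].
  by move: halts; rewrite -eq_t acc => -[<-].
have : tm_run M x T = tm_run M x t.
  move/ltnW/subnK: lt_tT <-; elim: (T - t) => // s IH.
  by rewrite addSn tm_runS IH /tm_step acc.
by move=> eq_T; move: halts; rewrite eq_T acc => -[<-].
Qed.

Definition accepting (c : cell) : bool :=
  if c.1.2 is Some q then tm_verdict q == Some true else false.

Variable W : nat.
Hypothesis W_gt : T.+1 < W.

(* The space-time diagram, with rows of length [W], read row by row. *)
Definition diagram (j : nat) : cell := cell_of (tm_run M x (j %/ W)) (j %% W).

Lemma diagram_row t i : i < W -> diagram (t * W + i) = cell_of (tm_run M x t) i.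
Proof.
move=> lt_i; rewrite /diagram divnMDl ?(leq_trans _ W_gt) // modnMDl.
by rewrite divn_small // modn_small // addn0.
Qed.

Lemma diagram_step j l : W <= j -> (W < j -> l = diagram (j - W.+1)) ->
  diagram j = delta l (diagram (j - W)) (diagram (j - W).+1).
Proof.
have W_gt0 : 0 < W by apply: leq_trans W_gt.
move=> le_Wj hl; have -> : diagram j =
    cell_of (tm_step (tm_run M x ((j - W) %/ W))) ((j - W) %% W).
  by rewrite /diagram -{1 2}(subnK le_Wj) divnDr ?dvdnn // divnn W_gt0 addn1 modnDr.
have [k eq_k] : exists k, j - W = k by exists (j - W).
have lt_kW := ltn_pmod k W_gt0.
have hl' : 0 < k -> l = diagram k.-1.
  by move=> k_gt0; rewrite hl; last lia; congr diagram; lia.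
rewrite eq_k; apply: cell_of_step.
  move=> mod_gt0; rewrite hl'; last by case: (k) mod_gt0; rewrite ?mod0n.
  have k_eq : k.-1 = k %/ W * W + (k %% W).-1.
    by rewrite [k in k.-1](divn_eq k W) -{1}(prednK mod_gt0) addnS.
  by rewrite k_eq diagram_row // (leq_ltn_trans (leq_pred _) lt_kW).
have [lt_SW|eq_SW] := ltnP (k %% W).+1 W.
  left; have k_eq : k.+1 = k %/ W * W + (k %% W).+1 by rewrite addnS -divn_eq.
  by rewrite k_eq diagram_row.
right; have k_eq : k.+1 = (k %/ W).+1 * W.
  have eq_W : (k %% W).+1 = W by apply/eqP; rewrite eqn_leq lt_kW.
  by rewrite {1}(divn_eq k W) -addnS eq_W mulSn addnC.
split; first by rewrite /diagram k_eq modnMl.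
by have := tm_head_run_le (k %/ W); lia.
Qed.

Lemma has_accepting J : T.+1 * W <= J ->
  has (fun i => accepting (diagram i)) (iota 0 J) = b.
Proof.
have W_gt0 : 0 < W by apply: leq_trans W_gt.
move=> le_J; apply/hasP/idP => [[i _]|b_true].
  rewrite /accepting /=; case: eqP => // _ /eqP; exact: accept_only_final.
have head_lt : tm_head (tm_run M x T) < W by have := tm_head_run_le T; lia.
exists (T * W + tm_head (tm_run M x T)).
  by rewrite mem_iota /=; lia.
by rewrite diagram_row // /accepting /cell_of /= eqxx halts b_true.
Qed.

Lemma diagram0 i : i < W ->
  diagram i = (omap inl (onth x i), if i == 0 then Some (tm_start M) else None, i == 0).
Proof.
by move=> lt_i; rewrite /diagram divn_small // modn_small //= /cell_of /= eq_sym.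
Qed.

End Run.
End Cells.

(** * The circuit of a space-time diagram *)

Lemma size_bits w n : size (bits w n) = w.
Proof. by elim: w n => //= w IH n; rewrite IH. Qed.

(* Symbolic addresses: absolute, or relative to one of two moving bases, the
   start of the previous block ([false]) and the start of the block preceding
   the left neighbour in the previous row ([true]). *)
Definition operand : Type := (nat + bool * nat)%type.

Definition addr (c r : nat) (o : operand) : nat :=
  match o with
  | inl a => a
  | inr (false, o) => c + o
  | inr (true, o) => r + o
  end.

Section Tableau.
Variables (R2 Q : finType) (q0 : Q) (next : Q -> Q -> Q -> Q) (acc : pred Q).
Variables (n : nat) (A : bool -> R2 -> rel 'I_n).

(* The bits computed by a block: the one-hot encoding of a cell, whether an
   accepting cell was seen in a block that is at least one row earlier, and the
   arcs of the graph selected by this bit in the previous block. *)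
Definition blockbit : finType := (Q + (unit + R2))%type.

Definition cellbit (q : Q) : blockbit := inl q.
Definition accbit : blockbit := inr (inl tt).
Definition arcbit (r : R2) : blockbit := inr (inr r).

(* The bits read by a block: three cells of the previous row, [accbit] of the
   previous block, and the arcs of the two graphs. *)
Definition readbit : finType := ('I_3 * Q + (unit + bool * R2))%type.

Definition decode (v : Q -> bool) : Q := odflt q0 [pick q | v q].

Lemma decode_onehot (v : Q -> bool) q : (forall q', v q' = (q == q')) -> decode v = q.
Proof.
move=> Hv; rewrite /decode; case: pickP => [q' |/(_ q)]; rewrite Hv ?eqxx //.
by move/eqP.
Qed.

Definition block_fun (p : blockbit) (v : {ffun readbit -> bool}) : bool :=
  let nb i := decode (fun q => v (inl (i, q))) in
  match p with
  | inl q => next (nb (inord 0)) (nb (inord 1)) (nb (inord 2)) == q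
  | inr (inl _) => v (inr (inl tt)) || acc (nb (inord 1))
  | inr (inr r) => v (inr (inr (v (inr (inl tt)), r)))
  end.

Definition block_forms : seq (form readbit) :=
  [seq form_of (block_fun p) | p <- enum blockbit].

Definition block_len : nat := block_size block_forms.

Definition bitpos (p : blockbit) : nat :=
  fsizes block_forms + index p (enum blockbit).

Lemma bitpos_lt p : bitpos p < block_len.
Proof.
by rewrite /bitpos /block_len /block_size size_map ltn_add2l index_mem mem_enum.
Qed.

Definition input_len : nat := 2 * up_log 2 n.

Definition vertex_bits (u v : 'I_n) : seq bool :=
  bits (up_log 2 n) u ++ bits (up_log 2 n) v.

Definition graph_fun (br : bool * R2) (a : {ffun 'I_input_len -> bool}) : bool :=
  [exists u, exists v, (a == [ffun i : 'I_input_len => nth false (vertex_bits u v) i])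
                       && A br.1 br.2 u v].

Definition graph_forms : seq (form 'I_input_len) :=
  [seq form_of (graph_fun br) | br <- enum {: bool * R2}].

Lemma size_vertex_bits u v : size (vertex_bits u v) = input_len.
Proof. by rewrite size_cat !size_bits addnn -mul2n. Qed.

Lemma vertex_bits_inj u v u' v' :
  vertex_bits u v = vertex_bits u' v' -> u = u' /\ v = v'.
Proof.
have lt_bits (i : 'I_n) : i < 2 ^ up_log 2 n by apply: leq_trans (up_logP n _).
move/eqP; rewrite eqseq_cat ?size_bits // => /andP[/eqP eq_u /eqP eq_v].
by split; apply: val_inj; apply: bits_inj (lt_bits _) (lt_bits _) _.
Qed.

Lemma graph_funE br u v :
  graph_fun br [ffun i : 'I_input_len => nth false (vertex_bits u v) i]
    = A br.1 br.2 u v.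
Proof.
apply/existsP/idP => [[u' /existsP[v' /andP[/eqP/ffunP eq_a A_uv]]]|A_uv]; last first.
  by exists u; apply/existsP; exists v; rewrite eqxx.
have [-> ->] // : u = u' /\ v = v'.
apply: vertex_bits_inj; apply: (eq_from_nth (x0 := false));
  rewrite !size_vertex_bits //.
by move=> i lt_i; have := eq_a (Ordinal lt_i); rewrite !ffunE.
Qed.

(* The first block refers to a nonexistent block on its left; the constants at
   the beginning make these addresses valid. *)
Definition prefix_gates : seq gate :=
  nseq block_len (GConst false) ++
  map (inst id) (block (addn block_len) (fun i : 'I_input_len => TInput i) graph_forms).

Definition graph_len : nat := block_size graph_forms.

Lemma size_prefix : size prefix_gates = block_len + graph_len.
Proof. by rewrite size_cat size_nseq size_map size_block. Qed.

Definition graphpos (br : bool * R2) : nat :=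
  block_len + fsizes graph_forms + index br (enum {: bool * R2}).

Lemma graphpos_lt br : graphpos br < block_len + graph_len.
Proof.
by rewrite /graphpos /graph_len /block_size -addnA !ltn_add2l size_map index_mem
  mem_enum.
Qed.

Definition read_operand (x : readbit) : operand :=
  match x with
  | inl (i, q) => inr (true, i * block_len + bitpos (cellbit q))
  | inr (inl _) => inr (false, bitpos accbit)
  | inr (inr br) => inl (graphpos br)
  end.

Definition gen_block : seq (tgate operand) :=
  block (fun p => inr (false, block_len + p) : operand)
    (fun x => TAnd (read_operand x) (read_operand x)) block_forms.

Lemma size_gen_block : size gen_block = block_len.
Proof. exact: size_block. Qed.

Definition init_block (q : Q) : seq bool :=
  nseq (fsizes block_forms) false ++ [seq p == cellbit q | p <- enum blockbit].

Lemma size_init_block q : size (init_block q) = block_len.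
Proof. by rewrite /block_len /block_size size_cat size_nseq !size_map. Qed.

Definition init_gates (W : nat) (Z : nat -> Q) : seq gate :=
  flatten (mkseq (fun i => map GConst (init_block (Z i))) W).

Definition gen_gates (W J : nat) : seq gate :=
  flatten (mkseq (fun j =>
    map (inst (addr (graph_len + block_len * (W + j)) (graph_len + block_len * j)))
      gen_block) J).

Definition tableau (W J : nat) (Z : nat -> Q) : circuit R2 :=
  Circuit (prefix_gates ++ init_gates W Z ++ gen_gates W J)
    [ffun r => graph_len + block_len * (W + J) + bitpos (arcbit r)].

Section Correct.
Variables (W J : nat) (Z : nat -> Q).
Hypothesis W_gt1 : 1 < W.
Hypothesis Z_next : forall j l, W <= j -> (W < j -> l = Z (j - W.+1)) ->
  Z j = next l (Z (j - W)) (Z (j - W).+1).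

Lemma size_init_gates : size (init_gates W Z) = block_len * W.
Proof.
rewrite size_flatten /shape -map_comp.
rewrite (@eq_map _ _ _ (fun=> block_len)); last first.
  by move=> i /=; rewrite size_map size_init_block.
by elim: (W) 0 => [|w IH] k /=; rewrite ?muln0 // IH mulnS.
Qed.

Lemma gen_gatesS j : gen_gates W j.+1 =
  gen_gates W j ++
  map (inst (addr (graph_len + block_len * (W + j)) (graph_len + block_len * j)))
    gen_block.
Proof. by rewrite /gen_gates /mkseq -addn1 iotaD map_cat flatten_cat /= cats0. Qed.

Lemma init_gatesS w : init_gates w.+1 Z =
  init_gates w Z ++ map GConst (init_block (Z w)).
Proof. by rewrite /init_gates /mkseq -addn1 iotaD map_cat flatten_cat /= cats0. Qed.

Lemma size_gen_gates j : size (gen_gates W j) = block_len * j.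
Proof.
elim: j => [|j IH]; first by rewrite muln0.
by rewrite gen_gatesS size_cat IH size_map size_gen_block mulnSr.
Qed.

Lemma tableau_wf : 0 < J -> circuit_wf input_len (tableau W J Z).
Proof.
move=> J_gt0; apply/andP; split; last first.
  apply/forallP => r; rewrite ffunE /= size_cat size_prefix size_cat size_init_gates.
  by rewrite size_gen_gates mulnDr; have := bitpos_lt (arcbit r); lia.
have wf_const gs k : gates_wf input_len k (map GConst gs) by elim: gs k => //=.
apply: gates_wfP; rewrite gates_wf_cat gates_wf_cat add0n size_prefix.
apply/andP; split.
  rewrite gates_wf_cat add0n size_nseq; apply/andP; split.
    by elim: (block_len) 0 => //=.
  by apply: wf_block => // v l _ /=.
apply/andP; split.
  move: (block_len + _) => k; elim: (W) => //= w IH.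
  by rewrite init_gatesS gates_wf_cat IH wf_const.
rewrite size_init_gates; elim: (J) => // j IH.
rewrite gen_gatesS gates_wf_cat IH size_gen_gates /=.
apply: wf_block => [p|x l le_l] /=; first by rewrite mulnDr; lia.
rewrite andbb; case: x => [[i q]|[[]|br]] /=.
- have lt_i : i * block_len <= 2 * block_len by rewrite leq_mul2r -ltnS ltn_ord orbT.
  have : 2 * block_len <= W * block_len by rewrite leq_mul2r W_gt1 orbT.
  have := bitpos_lt (cellbit q).
  lia.
- by have := bitpos_lt accbit; rewrite mulnDr in le_l *; lia.
by have := graphpos_lt br; lia.
Qed.

Variables u v : 'I_n.
Let inp := vertex_bits u v.

Definition blockval (j : nat) (p : blockbit) : bool :=
  match p with
  | inl q => Z j == q
  | inr (inl _) => has (fun i => acc (Z i)) (iota 0 (j.+1 - W))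
  | inr (inr r) =>
      (W <= j) && A (has (fun i => acc (Z i)) (iota 0 (j - W))) r u v
  end.

Definition blocks_done (j : nat) (vals : seq bool) : Prop :=
  [/\ size vals = block_len + graph_len + block_len * j,
      forall br, nth false vals (graphpos br) = A br.1 br.2 u v &
      forall i p, i < j ->
        nth false vals (block_len + graph_len + block_len * i + bitpos p) =
        blockval i p].

Lemma nth_enum_map (T : finType) (f : T -> bool) (a : nat) (us vs : seq bool) x :
  size us = a -> nth false (us ++ map f (enum T) ++ vs) (a + index x (enum T)) = f x.
Proof.
move=> sz_us; rewrite nth_cat -sz_us ltnNge leq_addr /= addKn nth_cat size_map.
by rewrite index_mem mem_enum (nth_map x) ?index_mem ?mem_enum // nth_index ?mem_enum.
Qed.

Lemma blocks_doneS j vals us : blocks_done j vals -> size us = fsizes block_forms ->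
  blocks_done j.+1 (vals ++ us ++ map (blockval j) (enum blockbit)).
Proof.
move=> [sz_vals graph_vals block_vals] sz_us.
have szK : size (us ++ map (blockval j) (enum blockbit)) = block_len.
  by rewrite /block_len /block_size size_cat sz_us !size_map.
split=> [|br|i p].
- by rewrite size_cat sz_vals szK mulnS; lia.
- rewrite nth_cat ifT ?graph_vals // sz_vals.
  by have := graphpos_lt br; lia.
rewrite ltnS leq_eqVlt => /orP[/eqP ->|lt_ij].
  rewrite catA -[_ ++ map _ _]cats0 -catA addnA nth_enum_map //.
  by rewrite size_cat sz_vals sz_us.
rewrite nth_cat ifT ?block_vals // sz_vals.
have : block_len * i.+1 <= block_len * j by rewrite leq_mul2l lt_ij orbT.
by rewrite mulnS; have := bitpos_lt p; lia.
Qed.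

Lemma eval_prefix : blocks_done 0 (eval_from inp [::] prefix_gates).
Proof.
rewrite /prefix_gates eval_from_cat.
have -> : eval_from inp [::] (nseq block_len (GConst false)) = nseq block_len false.
  rewrite -[RHS]cat0s; elim: (block_len) [::] => [|k IH] vals /=; first
    by rewrite cats0.
  by rewrite /eval_from /= -/(eval_from _ _ _) IH cat_rcons.
have [||vs eq_vs sz_vs] := @eval_block _ _ (addn block_len) (fun i
  : 'I_input_len => TInput i)
    id block_len (fun _ => erefl) inp (fun i => nth false inp i) (nseq block_len
      false) _ graph_forms.
- by [].
- by rewrite size_nseq.
rewrite eq_vs; split=> // [|br].
  rewrite !size_cat size_nseq sz_vs /graph_len /block_size !size_map muln0 addn0 //.
rewrite catA -[map _ _]cats0 /graph_forms -map_comp nth_enum_map.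
  rewrite /= feval_form_of -graph_funE; congr (graph_fun _ _).
by rewrite size_cat size_nseq sz_vs.
Qed.

Lemma eval_init w : w <= W ->
  blocks_done w (eval_from inp [::] (prefix_gates ++ init_gates w Z)).
Proof.
elim: w => [|w IH] lt_w; first by rewrite cats0; apply: eval_prefix.
have eval_const vals bs : eval_from inp vals (map GConst bs) = vals ++ bs.
  elim: bs vals => [|b bs IHbs] vals /=; first by rewrite cats0.
  by rewrite /eval_from /= -/(eval_from _ _ _) IHbs cat_rcons.
rewrite init_gatesS catA eval_from_cat eval_const /init_block.
have -> : [seq p == cellbit (Z w) | p <- enum blockbit]
  = map (blockval w) (enum blockbit).
  apply: eq_map => -[q|[[]|r]] /=; first exact: eq_sym.
    by rewrite (eqP (_ : w.+1 - W == 0)).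
  by rewrite leqNgt lt_w.
by apply: blocks_doneS; [apply: IH; apply: ltnW | rewrite size_nseq].
Qed.

Lemma eval_gen j :
  blocks_done (W + j) (eval_from inp [::] (prefix_gates ++ init_gates W Z
    ++ gen_gates W j)).
Proof.
elim: j => [|j IH]; first by rewrite addn0 cats0; apply: eval_init.
rewrite gen_gatesS 2!catA eval_from_cat -catA.
set vals := eval_from _ _ _ in IH *; have [sz_vals graph_vals block_vals] := IH.
pose h := addr (graph_len + block_len * (W + j)) (graph_len + block_len * j).
pose e x := nth false vals (h (read_operand x)).
have h_lt x : h (read_operand x) < size vals.
  rewrite sz_vals; case: x => [[i q]|[[]|br]] /=.
  - have lt_i : i * block_len <= 2 * block_len by rewrite leq_mul2r -ltnS ltn_ord orbT.
    have : 2 * block_len <= W * block_len by rewrite leq_mul2r W_gt1 orbT.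
    have := bitpos_lt (cellbit q).
    rewrite mulnDr; lia.
  - by have := bitpos_lt accbit; lia.
  by have := graphpos_lt br; lia.
have [p|x us||vs -> sz_vs] := @eval_block _ _ (fun p => inr (false, block_len + p)
  : operand)
  (fun x => TAnd (read_operand x) (read_operand x)) h (block_len + graph_len +
    block_len * (W + j)) _
  inp e vals _ block_forms.
- by rewrite /h /=; lia.
- by rewrite /= andbb nth_cat h_lt.
- by [].
rewrite /block_forms -map_comp addnS.
suff -> : map (feval e \o (fun p => form_of (block_fun p))) (enum blockbit) =
          map (blockval (W + j)) (enum blockbit) by apply: blocks_doneS.
have cell_e i k q : W + j + i = (k + W).+1 -> i < 3 -> e (inl (inord i, q))
  = (Z k == q).
  move=> eq_k lt_i.
  have := block_vals k (cellbit q); rewrite /e /h /= inordK // => <-; last by lia.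
  congr (nth _ _ _).
  have : block_len * (j + i) = block_len * k.+1 by congr (block_len * _); lia.
  by rewrite mulnDr mulnS; lia.
have mid_e : decode (fun q => e (inl (inord 1, q))) = Z j.
  by apply: decode_onehot => q; apply: cell_e; lia.
have acc_e : e (inr (inl tt)) = has (fun i => acc (Z i)) (iota 0 j).
  have := block_vals (W + j).-1 accbit; rewrite /e /h /=.
  rewrite (_ : (W + j).-1.+1 - W = j) => [<-|]; try lia.
    congr (nth _ _ _).
    have : block_len * (W + j) = block_len * (W + j).-1.+1 by congr (block_len * _);
      lia.
    by rewrite mulnS; lia.
have ffE (i : 'I_3) : decode (fun q => [ffun x => e x] (inl (i, q))) =
    decode (fun q => e (inl (i, q))).
  by congr odflt; apply: eq_pick => q; rewrite ffunE.
apply: eq_map => -[q|[[]|r]] /=; rewrite feval_form_of /= ?ffE ?ffunE ?mid_e.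
- have -> : decode (fun q => e (inl (inord 2, q))) = Z j.+1.
    by apply: decode_onehot => q'; apply: cell_e; lia.
  congr (_ == _); have := @Z_next (W + j) (decode (fun q => e (inl (inord 0, q)))).
  rewrite addKn => -> //; first exact: leq_addr.
  move=> lt_W; apply: decode_onehot => q'; apply: cell_e; lia.
- rewrite acc_e (_ : (W + j).+1 - W = j + 1); last by lia.
  by rewrite iotaD has_cat /= orbF.
by rewrite leq_addr addKn acc_e; apply: graph_vals.
Qed.

Lemma tableau_eval r : 0 < J ->
  circuit_eval (tableau W J Z) inp r = A (has (fun i => acc (Z i)) (iota 0 J.-1)) r u v.
Proof.
move=> J_gt0; have [_ _ block_vals] := eval_gen J.
rewrite /circuit_eval ffunE /=.
have lt_J : (W + J).-1 < W + J by lia.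
have := block_vals _ (arcbit r) lt_J.
rewrite /= (_ : W <= _); last by lia.
rewrite (_ : (W + J).-1 - W = J.-1) /=; last by lia.
move=> <-; congr (nth _ _ _).
have : block_len * (W + J) = block_len * (W + J).-1.+1 by congr (block_len * _); lia.
by rewrite mulnS; lia.
Qed.

End Correct.
End Tableau.

(** * Structured programs for transducers *)

Section Fragments.
Variables S T I : finType.

(* [Some None] marks cell 0 of a work tape. *)
Definition symbol := option (option bool).

Record store := Store {
  inh : nat;
  tp : I -> nat -> symbol;
  hd : I -> nat;
  out : seq T
}.

Record act := Act {
  act_in : move;
  act_work : I -> symbol * move;
  act_emit : option T
}.

Record frag := Frag {
  fstate : finType;
  fstart : fstate;
  fstep : fstate -> bool + S -> {ffun I -> symbol} -> (fstate + bool) * act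
}.

Variables (x : seq S) (bound : nat).

Definition do_act (a : act) (s : store) : store :=
  Store (minn (shift (act_in a) (inh s)) (size x).+1)
    (fun i => write (tp s i) (hd s i) (act_work a i).1)
    (fun i => shift (act_work a i).2 (hd s i))
    (if act_emit a is Some o then rcons (out s) o else out s).

Definition step_at (p : frag) (q : fstate p) (s : store) :=
  fstep q (in_sym x (inh s)) [ffun i => tp s i (hd s i)].

Inductive reach (p : frag) : fstate p -> store -> bool -> store -> Prop :=
| ReachExit q s b a : (forall i, hd s i <= bound) -> step_at q s = (inr b, a) ->
    reach q s b (do_act a s)
| ReachNext q s q' a b s' : (forall i, hd s i <= bound) ->
    step_at q s = (inl q', a) -> reach q' (do_act a s) b s' -> reach q s b s'.

Record astate := AState {
  ah : nat;
  als : {ffun I -> seq bool};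
  aout : seq T
}.

Definition tape_of (l : seq bool) (j : nat) : symbol :=
  if j is j.+1 then omap Some (onth l j) else Some None.

Definition rep (a : astate) (s : store) : Prop :=
  [/\ inh s = ah a /\ ah a <= (size x).+1, forall i, hd s i = 0,
      forall i j, tp s i j = tape_of (als a i) j & out s = aout a].

Definition does (p : frag) (a : astate) (b : bool) (a' : astate) : Prop :=
  forall s, rep a s -> exists2 s', reach (fstart p) s b s' & rep a' s'.

Definition fseq (p q : frag) : frag :=
  @Frag (fstate p + fstate q)%type (inl (fstart p))
    (fun st y w => match st with
     | inl st => let: (r, a) := fstep st y w in
         (if r is inl st' then inl (inl st') else inl (inr (fstart q)), a)
     | inr st => let: (r, a) := fstep st y w in
         (match r with inl st' => inl (inr st') | inr b => inr b end, a)
     end).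

Definition floop (p : frag) : frag :=
  @Frag (fstate p) (fstart p)
    (fun st y w => let: (r, a) := fstep st y w in
       (match r with inl st' => inl st' | inr true => inl (fstart p)
        | inr false => inr false end, a)).

Lemma reach_seq p q s b1 s1 b2 s2 : reach (fstart p) s b1 s1 ->
  reach (fstart q) s1 b2 s2 -> reach (fstart (fseq p q)) s b2 s2.
Proof.
move=> reach_p reach_q.
have {}reach_q : @reach (fseq p q) (inr (fstart q)) s1 b2 s2.
  elim: reach_q => [st s0 b c ok E|st s0 st' c b s3 ok E _ IH].
    by apply: ReachExit => //; rewrite /step_at /= [fstep _ _ _]E.
  by apply: ReachNext IH => //; rewrite /step_at /= [fstep _ _ _]E.
rewrite /=; elim: reach_p reach_q => [st s0 b c ok E|st s0 st' c b s3 ok E _ IH]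
  reach_q.
  by apply: ReachNext reach_q => //; rewrite /step_at /= [fstep _ _ _]E.
by apply: ReachNext (IH reach_q) => //; rewrite /step_at /= [fstep _ _ _]E.
Qed.

Lemma does_seq p q a b1 a1 b2 a2 :
  does p a b1 a1 -> does q a1 b2 a2 -> does (fseq p q) a b2 a2.
Proof.
move=> do_p do_q s /do_p[s1 reach_p /do_q[s2 reach_q rep_s2]].
by exists s2 => //; apply: reach_seq reach_p reach_q.
Qed.

Lemma does_loop_next p a a1 b a2 :
  does p a true a1 -> does (floop p) a1 b a2 -> does (floop p) a b a2.
Proof.
move=> do_p do_l s /do_p[s1 reach_p /do_l[s2 reach_l rep_s2]]; exists s2 => //=.
suff loop b0 st s0 s3 : @reach p st s0 b0 s3 -> b0 = true ->
    @reach (floop p) (fstart p) s3 b s2 -> @reach (floop p) st s0 b s2.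
  exact: loop reach_p erefl reach_l.
elim=> {}st {}s0 => [b' c ok E|st' c b' s4 ok E _ IH] eq_b {}reach_l.
  by subst b'; apply: ReachNext reach_l => //; rewrite /step_at /= [fstep _ _ _]E.
by apply: ReachNext (IH eq_b reach_l) => //; rewrite /step_at /= [fstep _ _ _]E.
Qed.

Lemma does_loop_exit p a a1 : does p a false a1 -> does (floop p) a false a1.
Proof.
move=> do_p s /do_p[s1 reach_p rep_s1]; exists s1 => //=.
suff loop b0 st s0 s3 : @reach p st s0 b0 s3 -> b0 = false ->
    @reach (floop p) st s0 false s3 by exact: loop reach_p erefl.
elim=> {}st {}s0 => [b' c ok E|st' c b' s4 ok E _ IH] eq_b.
  by subst b'; apply: ReachExit => //; rewrite /step_at /= [fstep _ _ _]E.
by apply: ReachNext (IH eq_b) => //; rewrite /step_at /= [fstep _ _ _]E.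
Qed.

Definition keep (w : {ffun I -> symbol}) (i : I) : symbol * move := (w i, Stay).

Definition fatom (g : bool + S -> move * option T * bool) : frag :=
  @Frag unit tt (fun _ y w => let: (d, o, b) := g y in (inr b, Act d (keep w) o)).

Definition emitted (o : option T) : seq T := if o is Some t then [:: t] else [::].

Lemma do_actE (a : act) s : out (do_act a s) = out s ++ emitted (act_emit a).
Proof. by rewrite /do_act /=; case: (act_emit a) => [t|]; rewrite ?cats1 ?cats0. Qed.

Lemma does_atom g a d o b : g (in_sym x (ah a)) = (d, o, b) ->
  does (fatom g) a b
    (AState (minn (shift d (ah a)) (size x).+1) (als a) (aout a ++ emitted o)).
Proof.
move=> g_a s [[eq_h le_h] hd0 eq_tp eq_out].
exists (do_act (Act d (keep [ffun i => tp s i (hd s i)]) o) s).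
  apply: ReachExit => [i|]; first by rewrite hd0.
  by rewrite /step_at /= eq_h g_a.
split=> [|i|i j|]; rewrite ?do_actE ?eq_out //= ?eq_h ?geq_minr //.
rewrite /write ffunE; case: eqP => [->|_]; exact: eq_tp.
Qed.

Section Sweep.
Variables (Q : finType) (i0 : I) (q0 : Q).
(* The digits on tape [i0] are rewritten from left to right by a Mealy machine,
   which may append one digit; then the head goes back to cell 0. *)
Variables (f : Q -> bool -> Q * bool * option T)
  (final : Q -> option bool * option T * bool).

Definition on_tape (w : {ffun I -> symbol}) (c : symbol) (d : move) (i : I) :=
  if i == i0 then (c, d) else keep w i.

Definition sweep_step (st : Q + bool) (_ : bool + S) (w : {ffun I -> symbol}) :
    (Q + bool + bool) * act :=
  match st with
  | inl q =>
    match w i0 with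
    | Some None => (inl (inl q), Act Stay (on_tape w (Some None) MoveR) None)
    | Some (Some c) => let: (q', c', o) := f q c in
        (inl (inl q'), Act Stay (on_tape w (Some (Some c')) MoveR) o)
    | None => let: (c, o, b) := final q in
        (inl (inr b), Act Stay (on_tape w (omap Some c) MoveL) o)
    end
  | inr b =>
    match w i0 with
    | Some None => (inr b, Act Stay (keep w) None)
    | c => (inl (inr b), Act Stay (on_tape w c MoveL) None)
    end
  end.

Definition fsweep : frag := @Frag (Q + bool)%type (inl q0) sweep_step.

Fixpoint mealy (q : Q) (l : seq bool) : Q * seq bool * seq T :=
  if l is c :: l then
    let: (q', c', o) := f q c in
    let: (q'', l', w) := mealy q' l in (q'', c' :: l', emitted o ++ w)
  else (q, [::], [::]).

Definition upd (ls : {ffun I -> seq bool}) (l : seq bool) : {ffun I -> seq bool} :=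
  [ffun i => if i == i0 then l else ls i].

Definition rep_at (k : nat) (a : astate) (s : store) : Prop :=
  [/\ inh s = ah a, forall i, hd s i = if i == i0 then k else 0,
      forall i j, tp s i j = tape_of (als a i) j & out s = aout a].

Lemma rep_at_act k a s w c d o l :
  rep_at k a s -> ah a <= (size x).+1 ->
  (forall j, tape_of l j = if j == k then c else tape_of (als a i0) j) ->
  w = [ffun i => tp s i (hd s i)] ->
  rep_at (shift d k) (AState (ah a) (upd (als a) l) (aout a ++ emitted o))
    (do_act (Act Stay (on_tape w c d) o) s).
Proof.
move=> [eq_h eq_hd eq_tp eq_out] le_h eq_l ->.
split=> [|i|i j|]; rewrite ?do_actE ?eq_out //=.
- by rewrite eq_h; apply/minn_idPl.
- by rewrite /on_tape eq_hd; case: eqP.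
rewrite /write /on_tape !ffunE eq_hd; case: (eqVneq i i0) => [->|ne_i] /=.
  by rewrite eq_l eq_tp.
by rewrite ffunE eq_hd (negPf ne_i); case: eqP => [->|_]; rewrite eq_tp.
Qed.

Lemma tape_of_cat l1 l2 k : tape_of (l1 ++ l2) (size l1 + k).+1 = tape_of l2 k.+1.
Proof. by rewrite /= onthE map_cat nth_cat size_map ltnNge leq_addr /= addKn -onthE.
  Qed.

Lemma sweep_back b a s k : rep_at k a s -> ah a <= (size x).+1 ->
  k <= size (als a i0) -> size (als a i0) < bound ->
  exists2 s', @reach fsweep (inr b) s b s' & rep a s'.
Proof.
elim: k s => [|k IH] s rep_s le_h le_k lt_size.
  have [eq_h eq_hd eq_tp eq_out] := rep_s.
  have hd0 i : hd s i = 0 by rewrite eq_hd if_same.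
  exists (do_act (Act Stay (keep [ffun i => tp s i (hd s i)]) None) s).
    apply: ReachExit => [i|]; first by rewrite hd0.
    by rewrite /step_at /= ffunE hd0 eq_tp.
  split=> [|i|i j|]; rewrite ?do_actE ?eq_out /= ?cats0 //.
    by split; rewrite // eq_h; apply/minn_idPl.
  by rewrite /write ffunE hd0; case: eqP => [->|_]; rewrite eq_tp.
have [eq_h eq_hd eq_tp eq_out] := rep_s.
have [c eq_c] : exists c, tp s i0 k.+1 = Some (Some c).
  by rewrite eq_tp /= onthE (nth_map false) //; exists (nth false (als a i0) k).
have ok i : hd s i <= bound by rewrite eq_hd; case: ifP => // _; lia.
have := @rep_at_act _ _ s _ (Some (Some c)) MoveL None (als a i0) rep_s le_h _ erefl.
rewrite /= cats0.
have -> : upd (als a) (als a i0) = als a by apply/ffunP => i; rewrite ffunE;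
  case: eqP => // ->.
case: a le_h lt_size le_k {eq_h eq_tp eq_out} eq_c rep_s IH => /= h ls o.
move=> le_h lt_size le_k eq_c [_ _ eq_tp _] IH rep_s'.
have [j|s' reach_s' rep_s''] := IH _ (rep_s' _) le_h (ltnW le_k) lt_size.
  by case: eqP => // ->; rewrite -eq_c eq_tp.
exists s' => //; apply: ReachNext reach_s' => //.
by rewrite /step_at /= ffunE eq_hd eqxx eq_c.
Qed.

Lemma does_sweep a q l w c o b :
  (size (als a i0)).+1 < bound ->
  mealy q0 (als a i0) = (q, l, w) -> final q = (c, o, b) ->
  does fsweep a b (AState (ah a)
    (upd (als a) (l ++ if c is Some d then [:: d] else [::]))
    (aout a ++ w ++ emitted o)).
Proof.
move=> lt_size eq_m eq_f s rep_s.
have scan l1 l2 q1 l2' w' q2 h ls out1 s1 :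
    rep_at (size l1).+1 (AState h (upd ls (l1 ++ l2)) out1) s1 ->
    h <= (size x).+1 -> (size (l1 ++ l2)).+1 < bound ->
    mealy q1 l2 = (q2, l2', w') -> final q2 = (c, o, b) ->
    exists2 s', @reach fsweep (inl q1) s1 b s' &
      rep (AState h (upd ls ((l1 ++ l2') ++ if c is Some d then [:: d] else [::]))
            (out1 ++ w' ++ emitted o)) s'.
  elim: l2 l1 q1 l2' w' out1 s1 => [|d l2 IH] l1 q1 l2' w' out1 s1 rep_s1 {}le_h lt_l1.
    case=> -> <- <- eq_c; rewrite !cats0 in rep_s1 lt_l1 *.
    have [_ eq_hd eq_tp _] := rep_s1.
    have nil_end : tp s1 i0 (size l1).+1 = None.
      by rewrite eq_tp /= ffunE eqxx onthE nth_default ?size_map.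
    have upd_upd l' l'' : upd (upd ls l') l'' = upd ls l''.
      by apply/ffunP => i; rewrite !ffunE; case: eqP.
    have := @rep_at_act _ _ s1 _ (omap Some c) MoveL o
      (l1 ++ if c is Some d then [:: d] else [::]) rep_s1 le_h _ erefl.
    rewrite /= upd_upd => rep_s2.
    have /rep_s2 {}rep_s2 : forall j,
        tape_of (l1 ++ if c is Some d then [:: d] else [::]) j =
        (if j == (size l1).+1 then omap Some c else tape_of (upd ls l1 i0) j).
      move=> j; rewrite ffunE eqxx; case: eqP => [->|].
        case: (c) => [d|]; last by rewrite cats0 /= onthE nth_default ?size_map.
        by have /= := tape_of_cat l1 [:: d] 0; rewrite addn0.
      case: j => //= j ne_j; case: (c) => [d|]; last by rewrite cats0.
      rewrite !onthE map_cat nth_cat size_map; case: ltngtP ne_j => // [lt_j _|-> //].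
      by rewrite !nth_default ?size_map /= ?subn_gt0 // ltnW.
    have [|||s' reach_s' rep_s'] := sweep_back b rep_s2; rewrite //= ?ffunE ?eqxx.
    - by rewrite size_cat leq_addr.
    - rewrite size_cat; case: (c) => [?|] /=; lia.
    exists s' => //; apply: ReachNext reach_s' => [i|].
      by rewrite eq_hd; case: ifP => // _; lia.
    by rewrite /step_at /= ffunE eq_hd eqxx nil_end eq_c.
  rewrite /=; case E: (f q1 d) => [[q1' d'] o'].
  case E': (mealy q1' l2) => [[q3 l3] w3] [eq_q <- <-] eq_c; rewrite eq_q in E'.
  have [_ eq_hd eq_tp _] := rep_s1.
  have eq_d : tp s1 i0 (size l1).+1 = Some (Some d).
    rewrite eq_tp /= ffunE eqxx.
    by have /= := tape_of_cat l1 (d :: l2) 0; rewrite addn0.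
  have := @rep_at_act _ _ s1 _ (Some (Some d')) MoveR o'
      (rcons l1 d' ++ l2) rep_s1 le_h _ erefl.
  have upd_upd l' l'' : upd (upd ls l') l'' = upd ls l''.
    by apply/ffunP => i; rewrite !ffunE; case: eqP.
  rewrite /= upd_upd => rep_s2.
  have /rep_s2 {}rep_s2 : forall j, tape_of (rcons l1 d' ++ l2) j =
      (if j == (size l1).+1 then Some (Some d') else
       tape_of (upd ls (l1 ++ d :: l2) i0) j).
    rewrite ffunE eqxx => -[|j] //=; rewrite eqSS !onthE cat_rcons !map_cat !nth_cat.
    rewrite size_map; case: ltngtP => // [lt_j|->]; last by rewrite subnn.
    by rewrite -(prednK (_ : 0 < j - size l1)) // subn_gt0.
  rewrite -(size_rcons l1 d') in rep_s2.
  have lt_l2 : (size (rcons l1 d' ++ l2)).+1 < bound.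
    by move: lt_l1; rewrite !size_cat size_rcons /= addSnnS.
  have [s'' reach_s'' rep_s''] := IH _ q1' l3 w3 _ _ rep_s2 le_h lt_l2 E' eq_c.
  exists s''; last first.
    by move: rep_s''; rewrite -!catA cat_rcons.
  apply: ReachNext reach_s'' => [i|].
    by rewrite eq_hd; case: ifP => // _; move: lt_l1; rewrite size_cat; lia.
  by rewrite /step_at /= ffunE eq_hd eqxx eq_d E.
have [[eq_h le_h] hd0 eq_tp eq_out] := rep_s.
have rep_s0 : rep_at 0 a s by split=> // i; rewrite hd0 if_same.
have := @rep_at_act _ _ s _ (Some None) MoveR None (als a i0) rep_s0 le_h _ erefl.
have tape0 j : tape_of (als a i0) j =
  if j == 0 then Some None else tape_of (als a i0) j by case: j.
rewrite /= cats0 => /(_ tape0) rep_s1.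
have [s' reach_s' rep_s'] :=
  scan [::] (als a i0) q0 l w q _ (als a) _ _ rep_s1 le_h lt_size eq_m eq_f.
exists s' => //; apply: ReachNext reach_s' => [i|]; first by rewrite hd0.
by rewrite /step_at /= ffunE hd0 eq_tp.
Qed.

End Sweep.
Definition finit : frag :=
  @Frag unit tt (fun _ _ _ => (inr true, Act Stay (fun=> (Some None, Stay)) None)).

Definition blank_store : store :=
  Store 0 (fun _ _ => None) (fun=> 0) [::].

Definition blank_astate : astate := AState 0 [ffun=> [::]] [::].

Lemma does_program p b a : does p blank_astate b a ->
  exists2 s, reach (fstart (fseq finit p)) blank_store b s & rep a s.
Proof.
move=> do_p; pose s1 := do_act (Act Stay (fun=> (Some None, Stay)) None) blank_store.
have [|s reach_s rep_s] := do_p s1.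
  by split=> [|//|i [|j]|]; rewrite /= ?min0n ?ffunE //; case: j.
exists s => //; apply: reach_seq reach_s; apply: ReachExit => //.
Qed.

Section Machine.
Variable p : frag.

Definition view (w : {ffun 'I_#|I| -> symbol}) : {ffun I -> symbol} :=
  [ffun i => w (enum_rank i)].

Definition machine : transducer S T :=
  @Transducer S T (option (fstate p)) (option bool) #|I| (Some (fstart p))
    (fun q => if q is Some _ then false else true)
    (fun q y w => if q is Some st then
       let: (r, a) := fstep st y (view w) in
       (if r is inl st' then Some st' else None, act_in a) else (None, Stay))
    (fun q y w i => if q is Some st then
       act_work (fstep st y (view w)).2 (enum_val i) else (None, Stay))
    (fun q y w => if q is Some st then act_emit (fstep st y (view w)).2 else None).

Definition simulates (c : tr_config machine) (q : option (fstate p)) (s : store) :=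
  [/\ tr_cur c = q, tr_inhead c = inh s,
      forall i j, tr_tape c i j = tp s (enum_val i) j,
      forall i, tr_head c i = hd s (enum_val i) & tr_out c = out s].

Lemma simulates_step c st s r a : simulates c (Some st) s -> step_at st s = (r, a) ->
  simulates (tr_step x c) (if r is inl st' then Some st' else None) (do_act a s).
Proof.
case: c => q h tape head o [/= -> -> eq_tape eq_head ->]; rewrite /step_at => E.
rewrite /tr_step /=.
have -> : view [ffun i => tape i (head i)] = [ffun i => tp s i (hd s i)].
  by apply/ffunP => i; rewrite !ffunE eq_tape eq_head enum_rankK.
by rewrite E; split=> //= i; rewrite ?eq_head // => j; rewrite /write eq_tape.
Qed.

Lemma simulates_reach st s b s' c : reach st s b s' -> simulates c (Some st) s ->
  (forall i, hd s' i <= bound) ->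
  exists2 t, simulates (iter t (@tr_step S T machine x) c) None s' &
    forall t' i, tr_head (iter t' (@tr_step S T machine x) c) i <= bound.
Proof.
move=> reach_s; elim: reach_s c => {st s b s'}
    [st s b a|st s st' a b s'] ok E => [c sim ok'|_ IH c sim ok'].
  have sim' := simulates_step sim E; exists 1 => // -[|t] i.
    by case: sim => _ _ _ -> _.
  have [cur _ _ eq_head _] := sim'.
  have -> : iter t.+1 (@tr_step S T machine x) c = tr_step x c; last by rewrite eq_head.
  elim: t => // t IH; rewrite iterS IH {1}/tr_step cur //=.
have [t sim_t ok_t] := IH _ (simulates_step sim E) ok'.
exists t.+1 => [|[|t'] i]; rewrite ?iterSr //.
by case: sim => _ _ _ -> _.
Qed.

Lemma machine_reach b s : reach (fstart p) blank_store b s ->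
  (forall i, hd s i <= bound) ->
  (exists t, tr_halt (tr_cur (tr_run machine x t)) /\
     tr_out (tr_run machine x t) = out s) /\
  forall t i, tr_head (tr_run machine x t) i <= bound.
Proof.
move=> reach_s ok_s.
have sim0 : simulates (tr_init machine) (Some (fstart p)) blank_store by split.
have [t [cur _ _ _ out_t] ok_t] := simulates_reach reach_s sim0 ok_s.
by split=> //; exists t; rewrite /tr_run cur.
Qed.

End Machine.
End Fragments.

Definition bin (v : nat) : seq bool := bits (up_log 2 v.+1) v.

Lemma nat_codeE v : nat_code v = rcons (map Some (bin v)) None.
Proof. by []. Qed.

Lemma size_bin v : size (bin v) = up_log 2 v.+1.
Proof. exact: size_bits. Qed.

Lemma binE v : 0 < v -> bin v = odd v :: bin v./2.
Proof. by move=> v_gt0; rewrite /bin up_log2S. Qed.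

Definition carry (T : Type) (c d : bool) : bool * bool * option T := (c && d, c (+)
  d, None).

Lemma mealy_inc (T : finType) v : exists c l,
  mealy (@carry T) true (bin v) = (c, l, [::]) /\
  l ++ (if c then [:: true] else [::]) = bin v.+1.
Proof.
have mealy0 l : mealy (@carry T) false l = (false, l, [::]).
  by elim: l => //= b l ->; case: b.
elim/ltn_ind: v => -[|v] IH; first by exists true, [::].
rewrite (binE (ltn0Sn v)) (binE (ltn0Sn v.+1)) /=; case: (boolP (odd v)) => odd_v /=.
  rewrite mealy0; exists false, (true :: bin (uphalf v)); split=> //.
  by rewrite cats0 uphalf_half odd_v.
have [|c [l [-> eq_l]]] := IH (uphalf v); first by lia.
exists c, (false :: l); split=> //=; by rewrite eq_l uphalf_half (negPf odd_v).
Qed.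

Definition val2 (l : seq bool) : nat := foldr (fun (b : bool) n => b + n.*2) 0 l.

Lemma mealy_tick (T : finType) b l : exists c l',
  [/\ mealy (@carry T) b l = (c, l', [::]), size l' = size l &
      val2 l' + c * 2 ^ size l = val2 l + b].
Proof.
elim: l b => [|d l IH] b; first by exists b, [::]; split=> //=; rewrite muln1.
have [c [l' [E sz_l' val_l']]] := IH (b && d).
exists c, ((b (+) d) :: l'); split; rewrite /= ?E ?sz_l' //.
have -> : c * 2 ^ (size l).+1 = (c * 2 ^ size l).*2 by rewrite expnS -mul2n mulnCA.
move: val_l'; case: b {E}; case: d => /=; lia.
Qed.

Lemma val2_lt l : val2 l < 2 ^ size l.
Proof. by elim: l => //= b l IH; rewrite expnS mul2n; case: b; lia. Qed.

Lemma val2_eq0 l : val2 l = 0 -> l = nseq (size l) false.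
Proof.
elim: l => //= b l IH eq0; rewrite -IH; last by lia.
by case: b eq0.
Qed.

Lemma val2_zeros L : val2 (nseq L false) = 0.
Proof. by elim: L => //= L ->. Qed.

Section Programs.
Variables (S I : finType) (x : seq S) (bound : nat).
Local Notation T := (option bool).
Local Notation frag := (frag S T I).
Local Notation astate := (astate T I).
Local Notation does := (@does S T I x bound).

Definition fskip : frag := fatom I (fun _ => (Stay, None, true)).

Definition fseqs (ps : seq frag) : frag := foldr (@fseq S T I) fskip ps.

Definition fmove (d : move) : frag := fatom I (fun _ => (d, None, true)).

Definition femit (w : seq T) : frag :=
  fseqs [seq fatom I (fun _ => (Stay, Some t, true)) | t <- w].

Definition finc (i : I) : frag :=
  fsweep S i true (@carry T) (fun c => (if c then Some true else None, None, true)).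

Definition ftick (i : I) : frag :=
  fsweep S i true (@carry T) (fun c => (None, None, ~~ c)).

Definition fzero (i : I) : frag :=
  fsweep S i tt (fun _ _ => (tt, false, None)) (fun _ => (None, None, true)).

Definition femitc (i : I) : frag :=
  fsweep S i tt (fun _ c => (tt, c, Some (Some c))) (fun _ => (None, Some None, true)).

Lemma does_wf p a b a' : (ah a <= (size x).+1 -> does p a b a') -> does p a b a'.
Proof. by move=> do_p s rep_s; have [[_ le_h] _ _ _] := rep_s; apply: do_p. Qed.

Lemma does_skip a : does fskip a true a.
Proof.
move=> s rep_s; have [[_ le_h] _ _ _] := rep_s.
have [s' reach_s' rep_s'] := @does_atom S T I x bound (fun=> (Stay, None, true))
  a Stay None true erefl s rep_s.
exists s' => //; move: rep_s'; rewrite /= cats0 (minn_idPl le_h).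
by case: (a).
Qed.

Lemma does_skip_eta a : does fskip a true (AState (ah a) (als a) (aout a)).
Proof. by case: a => h ls o; apply: does_skip. Qed.

Lemma does_cons p ps a b a1 b2 a2 :
  does p a b a1 -> does (fseqs ps) a1 b2 a2 -> does (fseqs (p :: ps)) a b2 a2.
Proof. exact: does_seq. Qed.

Lemma does_emit w a : does (femit w) a true (AState (ah a) (als a) (aout a ++ w)).
Proof.
elim: w a => [|t w IH] a; first by rewrite cats0; apply: does_skip_eta.
apply: does_wf => le_h; apply: does_cons; first exact: does_atom.
by have := IH (AState (minn (shift Stay (ah a)) (size x).+1) (als a) (aout a
  ++ [:: t]));
  rewrite /= (minn_idPl le_h) -catA.
Qed.

Lemma does_inc i a v : als a i = bin v -> (size (bin v)).+1 < bound ->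
  does (finc i) a true (AState (ah a) (upd i (als a) (bin v.+1)) (aout a)).
Proof.
move=> eq_i lt_v; have [c [l [E eq_l]]] := mealy_inc T v.
rewrite -eq_i in E lt_v.
have := @does_sweep S T I x bound bool i true (@carry T)
  (fun c => (if c then Some true else None, None, true)) a _ _ _ _ _ _ lt_v E erefl.
by rewrite !cats0 -eq_l; case: (c).
Qed.

Lemma does_zero i a : (size (als a i)).+1 < bound ->
  does (fzero i) a true (AState (ah a) (upd i (als a) (nseq (size (als a i)) false))
    (aout a)).
Proof.
move=> lt_i; have E l : mealy (fun _ _ => (tt, false, None)) tt l =
  (tt, nseq (size l) false, [::] : seq T) by elim: l => //= b l ->.
have := @does_sweep S T I x bound unit i tt (fun _ _ => (tt, false, None))
  (fun c => (None, None, true)) a _ _ _ _ _ _ lt_i (E _) erefl.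
by rewrite !cats0.
Qed.

Lemma does_emitc i a v : als a i = bin v -> (size (bin v)).+1 < bound ->
  does (femitc i) a true (AState (ah a) (als a) (aout a ++ nat_code v)).
Proof.
move=> eq_i lt_v; have E l : mealy (fun _ c => (tt, c, Some (Some c))) tt l =
  (tt, l, map Some l : seq T) by elim: l => //= b l ->.
rewrite -eq_i in lt_v.
have := @does_sweep S T I x bound unit i tt (fun _ c => (tt, c, Some (Some c)))
  (fun c => (None, Some None, true)) a _ _ _ _ _ _ lt_v (E _) erefl.
rewrite cats0 /= cats1 eq_i nat_codeE.
suff -> : upd i (als a) (bin v) = als a by [].
by apply/ffunP => j; rewrite ffunE; case: eqP => // ->.
Qed.

Definition fadd (i : I) (k : nat) : frag := fseqs (nseq k (finc i)).

Lemma does_add i k a v : als a i = bin v -> (up_log 2 (v + k).+1).+1 < bound ->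
  does (fadd i k) a true (AState (ah a) (upd i (als a) (bin (v + k))) (aout a)).
Proof.
elim: k a v => [|k IH] a v eq_i lt_v.
  have -> : upd i (als a) (bin (v + 0)) = als a.
    by apply/ffunP => j; rewrite ffunE; case: eqP => // ->; rewrite addn0.
  exact: does_skip_eta.
have lt_v' : (size (bin v)).+1 < bound.
  apply: leq_ltn_trans lt_v; rewrite size_bin ltnS; apply: leq_up_log; lia.
apply: does_cons (does_inc eq_i lt_v') _.
have := IH (AState (ah a) (upd i (als a) (bin v.+1)) (aout a)) v.+1.
rewrite /= ffunE eqxx addSnnS => /(_ erefl lt_v).
suff -> : upd i (upd i (als a) (bin v.+1)) (bin (v + k.+1)) =
  upd i (als a) (bin (v + k.+1)) by [].
by apply/ffunP => j; rewrite !ffunE; case: eqP.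
Qed.

Definition fadds (f : I -> nat) : frag := fseqs [seq fadd i (f i) | i <- enum I].

Lemma does_adds f a (v : I -> nat) :
  (forall i, 0 < f i -> als a i = bin (v i) /\ (up_log 2 (v i + f i).+1).+1 < bound) ->
  does (fadds f) a true
    (AState (ah a) [ffun i => if f i == 0 then als a i else bin (v i + f i)] (aout a)).
Proof.
move=> Hf; have Hf' i : i \in enum I -> 0 < f i ->
  als a i = bin (v i) /\ (up_log 2 (v i + f i).+1).+1 < bound by move=> _; apply: Hf.
have -> : [ffun i => if f i == 0 then als a i else bin (v i + f i)] =
  [ffun i => if (f i == 0) || (i \notin enum I) then als a i else bin (v i + f i)].
  by apply/ffunP => i; rewrite !ffunE mem_enum orbF.
rewrite /fadds; elim: (enum I) (enum_uniq I) a {Hf} Hf' => [|i s IH] /= uniq_s a Hf.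
  have -> : [ffun i => if (f i == 0) || (i \notin [::]) then als a i else bin (v i +
    f i)]
    = als a by apply/ffunP => i; rewrite ffunE orbT.
  exact: does_skip_eta.
case/andP: uniq_s => i_s uniq_s.
pose l := if f i == 0 then als a i else bin (v i + f i).
have do_i : does (fadd i (f i)) a true (AState (ah a) (upd i (als a) l) (aout a)).
  rewrite /l; case: eqP => [->|/eqP]; last first.
    by rewrite -lt0n => /Hf[|]; [apply: mem_head | apply: does_add].
  suff -> : upd i (als a) (als a i) = als a by apply: does_skip_eta.
  by apply/ffunP => j; rewrite ffunE; case: eqP => // ->.
apply: does_cons do_i _.
have := IH uniq_s (AState (ah a) (upd i (als a) l) (aout a)) _.
set ls := [ffun j => _]; set ls' := [ffun j => _].
have -> : ls = ls'.
  apply/ffunP => j; rewrite !ffunE in_cons; case: (eqVneq j i) => [->|] //=.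
  by rewrite i_s orbT orbF /l; case: (f i == 0).
apply=> j j_s; rewrite /= ffunE; have [eq_ji|_] := eqVneq j i.
  by rewrite eq_ji (negPf i_s) in j_s.
by apply: Hf; rewrite inE j_s orbT.
Qed.

End Programs.

Section Counters.
Variables (S : finType) (X k : nat).
Local Notation T := (option bool).

Definition tick : finType := (bool * 'I_k)%type.

(* Tape [inl (b, o)] holds the address of the operand [inr (b, o)]; the other
   tapes are loop counters with a fixed number of digits. *)
Definition tape : finType := (bool * 'I_X.+1 + tick)%type.

Record pstate := PState { ph : nat; pc : nat; pr : nat; pout : seq T }.

Definition tapes (c r : nat) (tk : {ffun tick -> seq bool}) : {ffun tape -> seq bool} :=
  [ffun i : tape => match i with
             | inl (b, o) => bin ((if b then r else c) + o)
             | inr t => tk t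
             end].

Definition mk (tk : {ffun tick -> seq bool}) (s : pstate) : astate T tape :=
  AState (ph s) (tapes (pc s) (pr s) tk) (pout s).

Variables (x : seq S) (bound : nat).

Local Notation frag := (frag S T tape).
Local Notation does := (@does S T tape x bound).

Section Loops.
Variable L : nat.
Hypothesis L_bound : L.+1 < bound.

Definition set_tick (t : tick) (l : seq bool) (tk : {ffun tick -> seq bool}) :
  {ffun tick -> seq bool} := [ffun t' => if t' == t then l else tk t'].

Lemma upd_tapes t l c r tk : upd (inr t : tape) (tapes c r tk) l
  = tapes c r (set_tick t l tk).
Proof. by apply/ffunP => -[[b o]|t']; rewrite !ffunE // ffunE. Qed.

Lemma does_tick t (tk : {ffun tick -> seq bool}) s : size (tk t) = L -> exists c l,
  [/\ does (ftick S (inr t)) (mk tk s) (~~ c) (mk (set_tick t l tk) s),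
      size l = L & val2 l + c * 2 ^ L = (val2 (tk t)).+1].
Proof.
move=> sz_t; have [c [l [E sz_l val_l]]] := mealy_tick T true (tk t).
exists c, l; split; rewrite ?sz_l // -?sz_t ?val_l ?addn1 //.
have lt_t : (size (als (mk tk s) (inr t))).+1 < bound by rewrite /= ffunE sz_t.
have E' : mealy (@carry T) true (als (mk tk s) (inr t)) = (c, l, [::])
  by rewrite /= ffunE.
have := @does_sweep S T tape x bound bool (inr t) true (@carry T)
  (fun c => (None, None, ~~ c)) (mk tk s) _ _ _ _ _ _ lt_t E' erefl.
by rewrite !cats0 /= upd_tapes.
Qed.

Definition fnest (ts : seq tick) (body : frag) : frag :=
  foldr (fun t p => floop (fseq p (ftick S (inr t)))) body ts.

Definition zeros : seq bool := nseq L false.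

Lemma does_nest (ts : seq tick) (body : frag) (st : nat -> pstate) N :
  (forall j (tk : {ffun tick -> seq bool}), j < N -> (forall t, size (tk t) = L) ->
    exists b, does body (mk tk (st j)) b (mk tk (st j.+1))) ->
  uniq ts -> forall j (tk : {ffun tick -> seq bool}), j + 2 ^ (L * size ts) <= N ->
  (forall t, size (tk t) = L) -> {in ts, forall t, tk t = zeros} ->
  exists b, does (fnest ts body) (mk tk (st j)) b (mk tk (st (j + 2 ^ (L * size ts)))).
Proof.
move=> do_body; elim: ts => [|t ts IH] /= uniq_ts j tk le_N sz_tk tk_zeros.
  by rewrite muln0 addn1; apply: do_body; rewrite // muln0 addn1 in le_N *.
case/andP: uniq_ts => t_ts uniq_ts; exists false.
have loop d : forall j (tk : {ffun tick -> seq bool}),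
    j + d.+1 * 2 ^ (L * size ts) <= N -> (forall t, size (tk t) = L) ->
    {in ts, forall t, tk t = zeros} -> d.+1 + val2 (tk t) = 2 ^ L ->
    does (floop (fseq (fnest ts body) (ftick S (inr t)))) (mk tk (st j)) false
      (mk (set_tick t zeros tk) (st (j + d.+1 * 2 ^ (L * size ts)))).
  elim: d => [|d IHd] {le_N sz_tk tk_zeros}j {}tk le_N sz_tk tk_zeros eq_d;
    rewrite mulSn addnA in le_N *;
    (have [|b do_nest] := IH uniq_ts j tk _ sz_tk tk_zeros; first by lia);
    have [c [l [do_tick sz_l val_l]]] := does_tick (st (j + 2 ^ (L * size ts)))
      (sz_tk t);
    have do_both := does_seq do_nest do_tick.
  - have c_true : c = true.
      by case: c val_l {do_tick do_both} => //; have := val2_lt l; rewrite sz_l; lia.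
    have l_zeros : l = zeros.
      rewrite /zeros -sz_l; apply: val2_eq0; move: val_l; rewrite c_true; lia.
    rewrite mul0n addn0 -l_zeros; rewrite c_true in do_both.
    exact: does_loop_exit do_both.
  have c_false : c = false.
    by case: c val_l {do_tick do_both} => // ; lia.
  rewrite c_false mul0n addn0 in do_both val_l.
  apply: does_loop_next do_both _.
  have -> : set_tick t zeros tk = set_tick t zeros (set_tick t l tk).
    by apply/ffunP => t'; rewrite !ffunE; case: eqP.
  apply: IHd => // [t'|t' t'_ts|].
  - by rewrite ffunE; case: eqP.
  - rewrite ffunE; case: eqP => [eq_t|_]; last exact: tk_zeros.
    by rewrite -eq_t t'_ts in t_ts.
  by rewrite ffunE eqxx val_l -eq_d addnS addSn.
have eq_tk : tk = set_tick t zeros tk.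
  apply/ffunP => t'; rewrite ffunE; case: eqP => // ->; by rewrite tk_zeros ?mem_head.
have L_gt0 : (2 ^ L).-1.+1 = 2 ^ L by rewrite prednK // expn_gt0.
rewrite {2}eq_tk mulnS expnD -L_gt0; apply: loop => //.
- by rewrite L_gt0 -expnD -mulnS.
- by move=> t' t'_ts; rewrite tk_zeros // inE t'_ts orbT.
by rewrite tk_zeros ?mem_head // val2_zeros addn0.
Qed.

End Loops.

Section Addresses.
Variable V : nat.
Hypothesis V_bound : (up_log 2 V.+1).+1 < bound.

Lemma bound_le v : v <= V -> (up_log 2 v.+1).+1 < bound.
Proof. by move=> le_v; apply: leq_ltn_trans V_bound; rewrite ltnS leq_up_log. Qed.

Definition fadvance (both : bool) (a : nat) : frag :=
  fadds S (fun i : tape => if i is inl (b, _) then if b ==> both then a else 0 else 0).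

Lemma does_advance (both : bool) a tk s :
  pc s + a + X <= V -> (both -> pr s + a + X <= V) ->
  does (fadvance both a) (mk tk s) true
    (mk tk (PState (ph s) (pc s + a) (if both then pr s + a else pr s) (pout s))).
Proof.
move=> le_c le_r.
have := @does_adds S tape x bound
  (fun i : tape => if i is inl (b, _) then if b ==> both then a else 0 else 0)
  (mk tk s)
  (fun i : tape => if i is inl (b, o) then (if b then pr s else pc s) + o else 0).
set ls := [ffun i => _].
have -> : ls = tapes (pc s + a) (if both then pr s + a else pr s) tk.
  apply/ffunP => -[[b o]|t]; rewrite !ffunE //=.
  by case: b; case: (both) => //=; case: (eqVneq a 0) => [->|_];
    rewrite ?addn0 // addnAC.
apply=> -[[b o]|t] //= lt0; rewrite ffunE; split=> //; apply: bound_le.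
have := ltn_ord o; case: b lt0 => /= => [|_]; last by lia.
by case: (both) le_r => // le_r _ lt_o; have := le_r isT; lia.
Qed.

Definition femit_operand (o : operand) : frag :=
  match o with
  | inl a => femit S tape (nat_code a)
  | inr (b, o) => femitc S (inl (b, inord o))
  end.

Definition offset_le (o : operand) : bool := if o is inr (_, o) then o <= X else true.

Lemma does_emit_operands (os : seq operand) tk s : all offset_le os ->
  pc s + X <= V -> pr s + X <= V ->
  does (fseqs (map femit_operand os)) (mk tk s) true
    (mk tk (PState (ph s) (pc s) (pr s)
      (pout s ++ flatten [seq nat_code (addr (pc s) (pr s) o) | o <- os]))).
Proof.
elim: os s => [|o os IH] s /=.
  by rewrite cats0; case: s => h c r w _ _ _; apply: does_skip.
case/andP => le_o le_os le_c le_r.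
have do_o : does (femit_operand o) (mk tk s) true
    (mk tk (PState (ph s) (pc s) (pr s) (pout s ++ nat_code (addr (pc s) (pr s) o)))).
  case: o le_o => [a _|[b o] /= le_o]; first exact: does_emit.
  have -> : (if b then pr s + o else pc s + o) = (if b then pr s else pc s) + o.
    by case: b.
  apply: (@does_emitc _ _ _ _ _ (mk tk s)).
    by rewrite /= ffunE inordK.
  by rewrite size_bin; apply: bound_le; case: b; lia.
have := IH (PState (ph s) (pc s) (pr s) (pout s ++ nat_code (addr (pc s) (pr s) o)))
  le_os le_c le_r.
rewrite /= -catA; exact: does_cons do_o.
Qed.

End Addresses.

Definition tgate_code (g : tgate operand) : seq operand :=
  match g with
  | TConst b => [:: inl 0; inl (b : nat); inl 0]
  | TInput i => [:: inl 1; inl i; inl 0]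
  | TNot i => [:: inl 2; i; inl 0]
  | TAnd i j => [:: inl 3; i; j]
  | TOr i j => [:: inl 4; i; j]
  end.

Definition gates_code (gs : seq gate) : seq T :=
  flatten (map nat_code (flatten (map gate_code gs))).

Lemma gates_code_cat gs gs' : gates_code (gs ++ gs') = gates_code gs ++ gates_code gs'.
Proof. by rewrite /gates_code map_cat flatten_cat map_cat flatten_cat. Qed.

Lemma tgate_codeE c r gs :
  flatten [seq nat_code (addr c r o) | o <- flatten (map tgate_code gs)] =
  gates_code (map (inst (addr c r)) gs).
Proof.
rewrite /gates_code map_comp; congr (flatten (map _ _)).
by elim: gs => //= g gs IH; rewrite map_cat IH; case: g.
Qed.

Definition femit_const (g : bool + S -> bool) : frag :=
  fseqs [:: femit S tape [:: None];
            fatom tape (fun y => (Stay, if g y then Some (Some true) else None, true));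
            femit S tape [:: None; None]].

Lemma does_const g tk s : does (femit_const g) (mk tk s) true
  (mk tk (PState (ph s) (pc s) (pr s)
    (pout s ++ gates_code [:: GConst (g (in_sym x (ph s)))]))).
Proof.
apply: does_wf => /= le_h; rewrite /femit_const.
apply: does_cons (@does_emit _ _ x bound [:: None] (mk tk s)) _.
apply: does_cons.
  by apply: does_atom; rewrite /=.
rewrite [minn _ _](minn_idPl _) //.
apply: does_cons (@does_emit _ _ x bound _ _) _; rewrite /mk /= -!catA.
suff -> : [:: None] ++ emitted (if g (in_sym x (ph s)) then Some (Some true) else
  None) ++
  [:: None; None] = gates_code [:: GConst (g (in_sym x (ph s)))] by exact: does_skip.
by case: (g _).
Qed.

End Counters.

(** * The reduction *)

Lemma in_sym_le (S : finType) (x : seq S) h : h <= size x -> in_sym x h != inl true.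
Proof.
case: h => //= h lt_h; rewrite onthE.
case: x lt_h => // s x lt_h; by rewrite (nth_map s).
Qed.

Lemma in_sym_end (S : finType) (x : seq S) : in_sym x (size x).+1 = inl true.
Proof. by rewrite /= onthE nth_default ?size_map. Qed.

Lemma in_sym_minn (S : finType) (x : seq S) i :
  (if in_sym x (minn i.+1 (size x).+1) is inr s then Some s else None) = onth x i.
Proof.
rewrite minnSS; case: (leqP i (size x)) => [_|lt_i] /=; first by case: onth.
by rewrite !onthE !nth_default ?size_map // ltnW.
Qed.

Definition offset (o : operand) : nat := if o is inr (_, o) then o else 0.

Definition max_offset (os : seq operand) : nat := foldr maxn 0 (map offset os).

Lemma offset_le_max (os : seq operand) operand_range : max_offset os
  <= operand_range -> all (offset_le operand_range) os.
Proof.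
elim: os => //= o os IH; rewrite /max_offset /= geq_max => /andP[le_o /IH ->].
by rewrite andbT; case: o le_o => [|[]].
Qed.

Section Reduction.
Variables (S R2 : finType) (M : tm S) (n : nat) (A : bool -> R2 -> rel 'I_n).
Variable k : nat.

Definition blank_cell : cell M := (None, None, false).

Local Notation block_len := (block_len R2 blank_cell (@delta S M) (@accepting S M)).
Local Notation graph_len := (graph_len A).
Local Notation prefix_gates := (prefix_gates blank_cell (@delta S M) (@accepting S M)
  A).
Local Notation gen_block := (gen_block blank_cell (@delta S M) (@accepting S M) A).
Local Notation bitpos := (bitpos blank_cell (@delta S M) (@accepting S M)).
Local Notation init_block := (init_block R2 blank_cell (@delta S M) (@accepting S M)).
Local Notation init_gates := (init_gates R2 blank_cell (@delta S M) (@accepting S M)).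
Local Notation gen_gates := (gen_gates blank_cell (@delta S M) (@accepting S M) A).
Local Notation tableau := (tableau blank_cell (@delta S M) (@accepting S M) A).

Definition block_operands : seq operand := flatten (map tgate_code gen_block).

Definition output_operands : seq operand :=
  [seq inr (false, bitpos (arcbit (cell M) r)) | r <- enum R2].

Definition operand_range : nat := max_offset (block_operands ++ output_operands).

Local Notation tape := (tape operand_range k).
Local Notation tick := (tick k).
Local Notation frag := (frag S (option bool) tape).

Definition input_symbol (y : bool + S) : option (S + tm_aux M) :=
  if y is inr s then Some (inl s) else None.

Definition first_cell (y : bool + S) : cell M :=
  (input_symbol y, Some (tm_start M), true).

Definition other_cell (y : bool + S) : cell M := (input_symbol y, None, false).

Definition femit_init (z : bool + S -> cell M) : frag :=
  fseqs [seq femit_const operand_range k (fun y => nth false (init_block (z y)) l) |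
    l <- iota 0 block_len].

Definition ftest (y0 : bool + S) : frag := fatom tape (fun y => (Stay, None, y != y0)).

Definition fcount : frag :=
  floop (fseq (fseq (fadds S (fun i : tape => if i is inr _ then 1 else 0))
                    (fmove S tape MoveR))
              (ftest (inl true))).

Definition frewind : frag := floop (fseq (fmove S tape MoveL) (ftest (inl false))).

Definition row_ticks (b : bool) : seq tick := [seq (b, i) | i <- enum 'I_k].

Definition fbody_init : frag :=
  fseqs [:: fmove S tape MoveR; femit_init other_cell;
    fadvance S operand_range k false block_len].

Definition fbody_gen : frag :=
  fseqs [:: fseqs (map (femit_operand S operand_range k) block_operands);
    fadvance S operand_range k true block_len].

Definition program : frag :=
  fseqs [:: fadds S (fun i : tape => if i is inl (_, o) then graph_len + o else 0);
            fcount; frewind;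
            fseqs [seq fzero S (inr t : tape) | t <- enum tick];
            fmove S tape MoveR;
            femit S tape (nat_code n ++ gates_code prefix_gates);
            femit_init first_cell; fadvance S operand_range k false block_len;
            fnest (row_ticks false) fbody_init;
            fnest (row_ticks false ++ row_ticks true) fbody_gen;
            fseqs (map (femit_operand S operand_range k) output_operands)].

Section Run.
Variables (x : seq S) (bound : nat).

Definition tick_len : nat := up_log 2 (size x).+2.
Definition loop_len : nat := 2 ^ (tick_len * k).
Definition top_addr : nat := graph_len + block_len * (loop_len.+1 + loop_len *
  loop_len) + operand_range.

Hypothesis addr_bound : (up_log 2 top_addr.+1).+1 < bound.
Hypothesis tick_bound : tick_len.+1 < bound.

Local Notation does := (@does S (option bool) tape x bound).
Local Notation mk := (@mk operand_range k).

Lemma does_move d tk s : does (fmove S tape d) (mk tk s) true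
  (mk tk (PState (minn (shift d (ph s)) (size x).+1) (pc s) (pr s) (pout s))).
Proof.
have := @does_atom S (option bool) tape x bound (fun=> (d, None, true)) (mk tk s) d
  None true erefl.
by rewrite /= cats0.
Qed.

Lemma does_test y0 tk s : does (ftest y0) (mk tk s) (in_sym x (ph s) != y0) (mk tk s).
Proof.
apply: does_wf => le_h.
have := @does_atom S (option bool) tape x bound (fun y => (Stay, None, y != y0))
  (mk tk s) Stay None (in_sym x (ph s) != y0) erefl.
by rewrite /= cats0 (minn_idPl le_h); case: s {le_h}.
Qed.

Lemma does_emit_init z tk s : does (femit_init z) (mk tk s) true
  (mk tk (PState (ph s) (pc s) (pr s)
    (pout s ++ gates_code (map GConst (init_block (z (in_sym x (ph s)))))))).
Proof.
set y := in_sym x (ph s).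
have -> : map GConst (init_block (z y)) =
  [seq GConst (g y) | g <- [seq fun y => nth false (init_block (z y)) l | l <- iota 0
    block_len]].
  by rewrite -map_comp -[X in map _ X = _](mkseq_nth false) size_init_block -map_comp.
rewrite /femit_init (map_comp (femit_const operand_range k));
  move: (map _ (iota 0 block_len)) => gs.
rewrite {}/y; elim: gs s => [|g gs IH] s /=.
  by rewrite cats0; case: s => h c r w; apply: does_skip.
apply: does_cons (@does_const _ _ _ _ _ _ _ _) _.
have := IH (PState (ph s) (pc s) (pr s)
  (pout s ++ gates_code [:: GConst (g (in_sym x (ph s)))])).
by rewrite /= -catA -gates_code_cat.
Qed.

Definition counting (v : nat) : {ffun tick -> seq bool} := [ffun=> bin v].

Lemma does_count_step h v c r w : h <= size x -> v <= size x ->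
  does (fseq (fseq (fadds S (fun i : tape => if i is inr _ then 1 else 0))
                   (fmove S tape MoveR)) (ftest (inl true)))
    (mk (counting v) (PState h c r w)) (in_sym x h.+1 != inl true)
    (mk (counting v.+1) (PState h.+1 c r w)).
Proof.
move=> le_h le_v.
have := @does_adds S tape x bound (fun i : tape => if i is inr _ then 1 else 0)
  (mk (counting v) (PState h c r w)) (fun i : tape => if i is inr _ then v else 0).
set ls := [ffun i => _].
have -> : ls = tapes operand_range c r (counting v.+1).
  by apply/ffunP => -[[b o]|t]; rewrite !ffunE //= addn1.
move=> do_adds.
have {}do_adds : does (fadds S (fun i : tape => if i is inr _ then 1 else 0))
    (mk (counting v) (PState h c r w)) true (mk (counting v.+1) (PState h c r w)).
  apply: do_adds => -[[b o]|t] //= _; rewrite !ffunE; split=> //.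
  by apply: leq_ltn_trans tick_bound; rewrite ltnS leq_up_log // addn1.
have := does_seq (does_seq do_adds (@does_move MoveR _ _)) (@does_test (inl true) _ _).
by rewrite /= (minn_idPl _).
Qed.

Lemma does_count h v c r w : h <= size x -> v + (size x - h).+1 <= (size x).+1 ->
  does fcount (mk (counting v) (PState h c r w)) false
    (mk (counting (v + (size x - h).+1)) (PState (size x).+1 c r w)).
Proof.
move=> le_h; have [d eq_d] : exists d, d = size x - h by eexists.
rewrite -eq_d; elim: d h v le_h eq_d => [|d IH] h v le_h eq_d le_v.
  have eq_h : h = size x by lia.
  rewrite addn1 eq_h; apply: does_loop_exit.
  have := @does_count_step (size x) v c r w (leqnn _).
  by rewrite in_sym_end eqxx; apply; lia.
apply: does_loop_next (_ : does _ _ _ (mk (counting v.+1) (PState h.+1 c r w))) _.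
  have le_h' : h.+1 <= size x by lia.
  have := @does_count_step h v c r w le_h.
  by rewrite in_sym_le //; apply; lia.
by rewrite -addSnnS; apply: IH; lia.
Qed.

Lemma does_rewind tk h c r w : h <= (size x).+1 ->
  does frewind (mk tk (PState h c r w)) false (mk tk (PState 0 c r w)).
Proof.
have step h' : does (fseq (fmove S tape MoveL) (ftest (inl false)))
    (mk tk (PState h' c r w)) (in_sym x (minn h'.-1 (size x).+1) != inl false)
    (mk tk (PState (minn h'.-1 (size x).+1) c r w)).
  by apply: does_seq (@does_move _ _ _) (@does_test _ _ _).
elim: h => [|h IH] le_h.
  by apply: does_loop_exit; have := step 0; rewrite min0n.
have := step h.+1; rewrite /= (minn_idPl (ltnW le_h)).
case: h IH le_h => [|h] IH le_h {}step; first exact: does_loop_exit.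
apply: does_loop_next _ (IH (ltnW le_h)); move: step.
by rewrite /in_sym; case: onth.
Qed.

Lemma does_zeros v s : (size (bin v)).+1 < bound ->
  does (fseqs [seq fzero S (inr t : tape) | t <- enum tick])
    (mk (counting v) s) true (mk [ffun=> nseq (size (bin v)) false] s).
Proof.
move=> lt_v.
pose tk (ts : seq tick) : {ffun tick -> seq bool} :=
  [ffun t => if t \in ts then bin v else nseq (size (bin v)) false].
have -> : counting v = tk (enum tick).
  by apply/ffunP => t; rewrite !ffunE mem_enum.
have -> : [ffun=> nseq (size (bin v)) false] = tk [::].
  by apply/ffunP => t; rewrite !ffunE.
elim: (enum tick) (enum_uniq tick) => [|t ts IH] /= => [_|/andP[t_ts uniq_ts]].
  exact: does_skip.
apply: does_cons (IH uniq_ts).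
have := @does_zero S tape x bound (inr t) (mk (tk (t :: ts)) s).
rewrite /= upd_tapes !ffunE mem_head => /(_ lt_v).
suff -> : set_tick t (nseq (size (bin v)) false) (tk (t :: ts)) = tk ts by apply.
by apply/ffunP => t'; rewrite !ffunE inE; case: eqP => [->|] //; rewrite (negPf t_ts).
Qed.

Definition cells : nat -> cell M := diagram M x loop_len.+1.

Lemma offsets_le : all (offset_le operand_range) (block_operands ++ output_operands).
Proof. exact: offset_le_max. Qed.

Definition after_init (w : seq (option bool)) (j : nat) : pstate :=
  PState (minn j.+1 (size x).+1) (graph_len + block_len * j.+1) graph_len (w
    ++ gates_code (init_gates j.+1 cells)).

Lemma top_addr_ge j : j <= loop_len.+1 + loop_len * loop_len -> graph_len + block_len
  * j + operand_range <= top_addr.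
Proof. by move=> le_j; rewrite leq_add2r leq_add2l leq_mul2l le_j orbT. Qed.

Lemma does_body_init w j tk : j < loop_len ->
  does fbody_init (mk tk (after_init w j)) true (mk tk (after_init w j.+1)).
Proof.
move=> lt_j; apply: does_cons (@does_move _ _ _) _.
apply: does_cons (@does_emit_init _ _ _) _.
have le_V : graph_len + block_len * j.+1 + block_len + operand_range <= top_addr.
  by have := @top_addr_ge j.+2; rewrite (mulnSr block_len j.+1) addnA; apply; lia.
apply: does_cons.
  by apply: (@does_advance _ _ _ x bound top_addr addr_bound false block_len).
rewrite /=.
have -> : minn (minn j.+1 (size x).+1).+1 (size x).+1 = minn j.+2 (size x).+1 by lia.
have -> : other_cell (in_sym x (minn j.+2 (size x).+1)) = cells j.+1.
  rewrite /cells diagram0 ?ltnS // -in_sym_minn /other_cell /input_symbol.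
  by case: in_sym.
rewrite -addnA -mulnSr -catA -gates_code_cat.
suff -> : init_gates j.+1 cells ++ [seq GConst i | i <- init_block (cells j.+1)] =
  init_gates j.+2 cells by exact: does_skip.
by rewrite [in RHS]init_gatesS.
Qed.

Definition after_gen (h : nat) (w : seq (option bool)) (j : nat) : pstate :=
  PState h (graph_len + block_len * (loop_len.+1 + j)) (graph_len + block_len * j) (w
    ++ gates_code (gen_gates loop_len.+1 j)).

Lemma does_body_gen h w j tk : j < loop_len * loop_len ->
  does fbody_gen (mk tk (after_gen h w j)) true (mk tk (after_gen h w j.+1)).
Proof.
move=> lt_j; have := offsets_le; rewrite all_cat => /andP[le_block _].
have le_c i : i <= j.+1 -> graph_len + block_len * (loop_len.+1 + i) + operand_range
  <= top_addr by move=> le_i; apply: top_addr_ge; lia.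
have le_r i : i <= j.+1 -> graph_len + block_len * i + operand_range <= top_addr
  by move=> le_i; apply: top_addr_ge; lia.
apply: does_cons.
  by apply: (@does_emit_operands _ _ _ x bound top_addr addr_bound);
    [|exact: le_c|exact: le_r].
have le_c' : graph_len + block_len * (loop_len.+1 + j) + block_len + operand_range
  <= top_addr.
  by have := le_c j.+1 (leqnn _); rewrite addnS mulnSr addnA.
have le_r' : graph_len + block_len * j + block_len + operand_range <= top_addr.
  by have := le_r j.+1 (leqnn _); rewrite mulnSr addnA.
apply: does_cons; first by apply: (@does_advance _ _ _ x bound top_addr addr_bound
  true block_len).
rewrite /=.
rewrite tgate_codeE -catA -gates_code_cat -gen_gatesS.
have -> : graph_len + block_len * (loop_len.+1 + j) + block_len
  = graph_len + block_len * (loop_len.+1 + j.+1) by rewrite addnS mulnSr addnA.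
have -> : graph_len + block_len * j + block_len = graph_len + block_len * j.+1
  by rewrite mulnSr addnA.
exact: does_skip.
Qed.

Lemma does_reduction : exists s, does program (blank_astate (option bool) tape) true
  s /\
  aout s = succinct_code n (tableau loop_len.+1 (loop_len * loop_len) cells).
Proof.
have setup : does (fadds S (fun i : tape => if i is inl (_, o) then graph_len + o
  else 0))
    (blank_astate (option bool) tape) true (mk (counting 0) (PState 0 graph_len
      graph_len [::])).
  have := @does_adds S tape x bound (fun i : tape => if i is inl (_, o) then
    graph_len + o else 0)
    (blank_astate (option bool) tape) (fun=> 0).
  set ls := [ffun i => _].
  have -> : ls = tapes operand_range graph_len graph_len (counting 0).
    apply/ffunP => -[[b o]|t]; rewrite !ffunE //= !if_same.
    by case: eqP => // ->.
  apply=> -[[b o]|t] //= _; rewrite ffunE; split=> //; apply: (bound_le addr_bound).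
  by have := ltn_ord o; rewrite /top_addr; lia.
have count := @does_count 0 0 graph_len graph_len [::] (leq0n _).
rewrite subn0 add0n in count; have {}count := count (leqnn _).
have rewind := @does_rewind (counting (size x).+1) (size x).+1 graph_len graph_len
  [::] (leqnn _).
have zero := @does_zeros (size x).+1 (PState 0 graph_len graph_len [::]).
rewrite size_bin -/tick_len in zero; have {}zero := zero tick_bound.
move: setup count rewind zero; set tk0 : {ffun tick -> seq bool} := [ffun=> nseq
  tick_len false].
move=> setup count rewind zero.
have sz_tk0 t : size (tk0 t) = tick_len by rewrite ffunE size_nseq.
have zeros_tk0 (ts : seq tick) : {in ts, forall t, tk0 t = zeros tick_len}.
  by move=> t _; rewrite ffunE.
have move1 : does (fmove S tape MoveR) (mk tk0 (PState 0 graph_len graph_len [::])) true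
    (mk tk0 (PState 1 graph_len graph_len [::])).
  by have := @does_move MoveR tk0 (PState 0 graph_len graph_len [::]);
    rewrite /= (minn_idPl _).
pose w := nat_code n ++ gates_code prefix_gates.
have sz_ticks b : size (row_ticks b) = k by rewrite size_map size_enum_ord.
have uniq_ticks b : uniq (row_ticks b).
  by rewrite map_inj_uniq ?enum_uniq // => i j [].
have le_V : graph_len + block_len + operand_range <= top_addr
  by have := @top_addr_ge 1; rewrite muln1; apply; lia.
have [||b1 nest1] := @does_nest S operand_range k x bound tick_len tick_bound
  (row_ticks false) fbody_init
    (after_init w) loop_len _ (uniq_ticks _) 0 tk0 _ sz_tk0 (@zeros_tk0 _).
- by move=> j tk lt_j _; exists true; apply: does_body_init.
- by rewrite sz_ticks.
pose h := minn loop_len.+1 (size x).+1.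
pose w' := w ++ gates_code (init_gates loop_len.+1 cells).
have eq_J : 2 ^ (tick_len * size (row_ticks false ++ row_ticks true))
  = loop_len * loop_len.
  by rewrite size_cat !sz_ticks mulnDr expnD.
have uniq2 : uniq (row_ticks false ++ row_ticks true).
  rewrite cat_uniq !uniq_ticks andbT /= -all_predC; apply/allP => t /mapP[i _ ->].
  by apply/mapP => -[].
have [||b2 nest2] := @does_nest S operand_range k x bound tick_len tick_bound _
  fbody_gen
    (after_gen h w') (loop_len * loop_len) _ uniq2 0 tk0 _ sz_tk0 (@zeros_tk0 _).
- by move=> j tk lt_j _; exists true; apply: does_body_gen.
- by rewrite eq_J.
rewrite add0n sz_ticks -/loop_len in nest1; rewrite add0n eq_J in nest2.
have init_end : after_init w loop_len = after_gen h w' 0.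
  by rewrite /after_init /after_gen /gen_gates /= muln0 !addn0 cats0.
have init_start : after_init w 0 = PState 1 (graph_len + block_len) graph_len
    (w ++ gates_code (map GConst (init_block (first_cell (in_sym x 1))))).
  rewrite /after_init muln1 (minn_idPl _) // init_gatesS /=.
  have -> : cells 0 = first_cell (in_sym x 1); last by [].
  rewrite /cells diagram0 // -in_sym_minn (minn_idPl _) // /first_cell /input_symbol.
  by case: in_sym.
rewrite init_end init_start in nest1.
have := offsets_le; rewrite all_cat => /andP[_ le_out].
have outs := @does_emit_operands S operand_range k x bound top_addr addr_bound
  output_operands tk0
  (after_gen h w' (loop_len * loop_len)) le_out (top_addr_ge (leqnn _)) (top_addr_ge
    (leq_addl _ _)).
eexists; split.
  apply: does_cons setup _.
  apply: does_cons count _.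
  apply: does_cons rewind _.
  apply: does_cons zero _.
  apply: does_cons move1 _.
  apply: does_cons (@does_emit _ _ _ _ _ _) _.
  apply: does_cons (@does_emit_init _ tk0 (PState 1 graph_len graph_len w)) _.
  apply: does_cons; first by apply: (@does_advance S operand_range k x bound top_addr
    addr_bound false block_len).
  apply: does_cons nest1 _.
  apply: does_cons nest2 _.
  apply: does_cons outs _.
  exact: does_skip.
rewrite /w' /w /succinct_code [aout _]/= -!catA [map nat_code _]/= [flatten (_ :: _)]/=.
congr (_ ++ _); rewrite map_cat flatten_cat -/(gates_code _).
rewrite (gates_code_cat prefix_gates) (gates_code_cat (init_gates _ _)) -!catA.
congr (_ ++ (_ ++ (_ ++ _))); rewrite /output_operands -!map_comp; congr flatten.
by apply: eq_map => r; rewrite /= ffunE.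
Qed.

End Run.
End Reduction.

Section Reduction.
Variables (S R2 : finType) (M : tm S) (n : nat) (A : bool -> R2 -> rel 'I_n) (c : nat).

Lemma loop_len_gt (x : seq S) : size x ^ c + c + 3 <= loop_len c.+2 x.
Proof.
set s := size x; have le_L : s.+2 <= 2 ^ tick_len x by apply: up_logP.
rewrite /loop_len expnM; apply: leq_trans (_ : s.+2 ^ c.+2 <= _); last
  by rewrite leq_exp2r.
have pow_s : s ^ c <= s.+2 ^ c by case: (c) => // c'; rewrite leq_exp2r //; lia.
have pow_c : c < s.+2 ^ c.
  apply: leq_trans (ltn_expl c (ltnSn 1)) _.
  by case: (c) => // c'; rewrite leq_exp2r.
rewrite !expnS mulnA; have : 4 * s.+2 ^ c <= s.+2 * s.+2 * s.+2 ^ c.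
  by rewrite leq_mul2r; apply/orP; right; lia.
lia.
Qed.

Definition reduction (x : seq S) : circuit R2 :=
  tableau (blank_cell M) (@delta S M) (@accepting S M) A (loop_len c.+2 x).+1
    (loop_len c.+2 x * loop_len c.+2 x) (cells M c.+2 x).

Lemma reduction_logspace :
  logspace_computable (fun x => succinct_code n (reduction x)).
Proof.
pose p : frag S (option bool) (tape (operand_range M A) c.+2) := program M A c.+2.
pose kappa := up_log 2 (graph_len A + operand_range M A +
  3 * block_len R2 (blank_cell M) (@delta S M) (@accepting S M)).+1.
exists (machine (fseq (finit _ _ _) p)), (kappa + c.+2 * 4 + 5) => x.
pose bound := kappa + tick_len x * (c.+2 * 2) + tick_len x + 3.
have le_bound : bound <= (kappa + c.+2 * 4 + 5) * up_log 2 (size x) + (kappa + c.+2 *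
  4 + 5).
  have le_L : tick_len x <= up_log 2 (size x) + 2.
    apply: up_log_min => //; have := up_logP (size x) (ltnSn 1).
    rewrite expnD; have : 0 < 2 ^ up_log 2 (size x) by rewrite expn_gt0.
    lia.
  have le_mul : tick_len x * (c.+2 * 2) <= (up_log 2 (size x) + 2) * (c.+2 * 2).
    by rewrite leq_mul2r le_L orbT.
  move: le_mul le_L; rewrite /bound; move: (tick_len x) (up_log 2 (size x)) => l u.
  nia.
have addr_bound : (up_log 2 (top_addr M A c.+2 x).+1).+1 < bound.
  suff : up_log 2 (top_addr M A c.+2 x).+1 <= kappa + tick_len x * (c.+2 * 2)
    by rewrite /bound; lia.
  apply: up_log_min => //; rewrite expnD.
  have Y2 : 2 ^ (tick_len x * (c.+2 * 2)) = loop_len c.+2 x * loop_len c.+2 x.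
    by rewrite /loop_len -expnD; congr (2 ^ _); lia.
  rewrite Y2; have := up_logP (graph_len A + operand_range M A +
    3 * block_len R2 (blank_cell M) (@delta S M) (@accepting S M)).+1 (ltnSn 1).
  rewrite -/kappa; move: (2 ^ kappa) => q le_q.
  have Y_gt0 : 0 < loop_len c.+2 x by rewrite expn_gt0.
  apply: leq_trans (leq_mul le_q (leqnn _)).
  rewrite /top_addr; move: (loop_len _ _) Y_gt0 (block_len _ _ _ _) (graph_len _)
    (operand_range _ _) => y y_gt0 k b d.
  have [z eq_z] : exists z, z = y * y by eexists.
  rewrite -eq_z; have : y <= z by rewrite eq_z leq_pmulr.
  move=> le_y; nia.
have tick_bound : (tick_len x).+1 < bound by rewrite /bound; lia.
have [a [do_p out_a]] := @does_reduction _ _ M n A c.+2 x bound addr_bound tick_bound.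
have [s reach_s [_ hd_s _ out_s]] := does_program do_p.
have [i|] := machine_reach reach_s; first by rewrite hd_s.
rewrite out_s out_a => run_out heads; split=> // t i.
exact: leq_trans (heads t i) le_bound.
Qed.

Lemma reduction_correct (x : seq S) (b : bool) :
  tm_verdict (tm_cur (tm_run M x (size x ^ c + c))) = Some b -> 0 < n ->
  succinct_wf n (reduction x) /\
  forall r u v, arc (r := succinct_graph n (reduction x)) r u v = A b r u v.
Proof.
move=> halts n_gt0; have le_Y := loop_len_gt x.
have W_gt : (size x ^ c + c).+1 < (loop_len c.+2 x).+1 by lia.
have W_gt1 : 1 < (loop_len c.+2 x).+1 by lia.
have J_gt0 : 0 < loop_len c.+2 x * loop_len c.+2 x by rewrite muln_gt0; lia.
have next := diagram_step halts W_gt.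
split; first by rewrite /succinct_wf n_gt0 tableau_wf.
move=> r u v; rewrite /= (tableau_eval _ _ _ W_gt1 next) //.
rewrite (has_accepting halts W_gt) //.
move: (loop_len c.+2 x) le_Y => y; move: (size x ^ c + c) => t le_t.
have : t.+1 * y.+1 <= (y - 2) * y.+1 by rewrite leq_mul2r; lia.
have : (y - 2) * y.+1 <= (y * y).-1 by nia.
lia.
Qed.

End Reduction.

Theorem theorem3 (R2 : finType) (psi chi : sentence R2)
  (h : cw_size_independent psi chi) :
  P_hard (under_dynamics psi chi).
Proof.
have [k /(_ 1)[n n_gt0 [G [G' [[card_G _ sat_G] [card_G' _ sat_G']]]]]] := h.
move=> S lang [M [c run_M]].
pose g (u : 'I_n) : G := enum_val (cast_ord (esym card_G) u).
pose g' (u : 'I_n) : G' := enum_val (cast_ord (esym card_G') u).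
pose A (b : bool) (r : R2) (u v : 'I_n) :=
  if b then arc r (g u) (g v) else arc r (g' u) (g' v).
exists (fun x => succinct_code n (reduction M A c x)).
split=> [|x]; first exact: reduction_logspace.
have [b halts b_L] := run_M x.
have [wf_D arc_D] := @reduction_correct S R2 M n A c x b halts n_gt0.
have iso (H : rgraph R2) (card_H : #|H| = n) :
    (forall r (u v : 'I_n), A b r u v =
       arc r (enum_val (cast_ord (esym card_H) u)) (enum_val (cast_ord (esym card_H)
         v))) ->
    isomorphic H (succinct_graph n (reduction M A c x)).
  move=> A_H; exists (fun v => cast_ord card_H (enum_rank v)).
    exists (fun u => enum_val (cast_ord (esym card_H) u)) => u.
      by rewrite cast_ordK enum_rankK.
    by rewrite enum_valK cast_ordKV.
  by move=> r u v; rewrite arc_D A_H !cast_ordK !enum_rankK.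
split=> [Lx|nLx]; exists n, (reduction M A c x).
  have b_true : b by apply/b_L.
  have iso_G : isomorphic G (succinct_graph n (reduction M A c x)).
    by apply: (iso _ card_G) => r u v; rewrite /A b_true.
  by move: sat_G => /andP[sat_psi sat_chi]; split; rewrite // (models_iso _ iso_G).
have b_false : b = false by apply/negP => /b_L.
have iso_G : isomorphic G' (succinct_graph n (reduction M A c x)).
  by apply: (iso _ card_G') => r u v; rewrite /A b_false.
by move: sat_G' => /andP[sat_psi sat_chi]; split; rewrite // (models_iso _ iso_G).
Qed.
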